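(* A permutation sequence $(\sigma_n)_{n\in\mathbb{N}}$ converges if and only if it is a Cauchy sequence with respect to the metric $d_{\square}$.
   Context: A permutation is a bijection $\sigma:[n]\to[n]$, $[n]=\{1,\dots,n\}$, $n\ge1$. $[n]^k_<$ is the set of strictly increasing $k$-tuples in $[n]$. For permutations $\tau$ of $[k]$ and $\pi$ of $[n]$, $\Lambda(\tau,\pi)$ is the number of $(x_1,\dots,x_k)\in[n]^k_<$ such that, for all $i,j$, $\pi(x_i)<\pi(x_j)$ if and only if $\tau(i)<\tau(j)$; $t(\tau,\pi)=\binom nk^{-1}\Lambda(\tau,\pi)$ if $k\le n$, and $t(\tau,\pi)=0$ if $k>n$. A permutation sequence $(\sigma_n)$ converges if, for every fixed permutation $\tau$, the real sequence $(t(\tau,\sigma_n))_n$ converges. A cdf is a non-decreasing left-continuous function $F:[0,1]\to[0,1]$ with $F(0)=0$; $\mu_F$ is the Borel probability measure on $[0,1]$ with $\mu_F([0,1])=1$ and $\mu_F([a,b))=F(b)-F(a)$ for $0\le a<b\le1$. For measurable $Z_1,Z_2:[0,1]^2\to[0,1]$ such that $Z_i(x,\cdot)$ is a cdf for every $x$, the rectangular distance is $$d_{\square}(Z_1,Z_2)=\sup_{\substack{x_1<x_2\in[0,1]\\ \alpha_1<\alpha_2\in[0,1]}}\Big|\int_{x_1}^{x_2}\mu_{Z_1(x,\cdot)}([\alpha_1,\alpha_2])\,dx-\int_{x_1}^{x_2}\mu_{Z_2(x,\cdot)}([\alpha_1,\alpha_2])\,dx\Big|.$$ With a permutation $\sigma$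 of $[n]$ one associates the step function $Z_\sigma:[0,1]^2\to[0,1]$ given by $Z_\sigma(x,0)=0$; $Z_\sigma(0,y)=\lceil ny\rceil/n$ for $y>0$; and, for $x,y>0$, $Z_\sigma(x,y)=1$ if $\sigma(\lceil nx\rceil)<\lceil ny\rceil$ and $Z_\sigma(x,y)=0$ otherwise. For permutations $\sigma,\pi$ (possibly of different lengths), $d_{\square}(\sigma,\pi)=d_{\square}(Z_\sigma,Z_\pi)$. (For $\sigma_1,\sigma_2$ of the same length $n$ this equals $\frac1n\max_{S,T}\big||\sigma_1(S)\cap T|-|\sigma_2(S)\cap T|\big|$, the maximum being over intervals $S,T$ of $[n]$.) $(\sigma_n)$ is a Cauchy sequence with respect to $d_{\square}$ if for every $\varepsilon>0$ there is $n_0$ such that $d_{\square}(\sigma_n,\sigma_m)<\varepsilon$ for all $n,m\ge n_0$. *)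

(* Defs.v *)
From HB Require Import structures.
From mathcomp Require Import all_boot all_order all_algebra perm.
From mathcomp Require Import all_classical all_reals all_analysis.
From mathcomp Require Import measurable_realfun lra.

Set Implicit Arguments.
Unset Strict Implicit.
Unset Printing Implicit Defensive.

Import Order.TTheory GRing.Theory Num.Theory.
Import numFieldNormedType.Exports.

Local Open Scope classical_set_scope.
Local Open Scope ring_scope.

(* The element [i] of ['I_n] stands for the element [i.+1] of {1, ..., n}. *)

Definition occurrences k n (tau : 'S_k) (pi : 'S_n) : {set k.-tuple 'I_n} :=
  [set x : k.-tuple 'I_n | sorted ltn (map val x) &&
    [forall i : 'I_k, forall j : 'I_k,
      (pi (tnth x i) < pi (tnth x j))%N == (tau i < tau j)%N]]%SET.

Definition perm_density (R : realType) k n (tau : 'S_k) (pi : 'S_n) : R :=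
  if (k <= n)%N then #|occurrences tau pi|%:R / 'C(n, k)%:R else 0.

Definition converges (R : realType) (len : nat -> nat)
    (sigma : forall n, 'S_(len n)) : Prop :=
  forall k (tau : 'S_k), (0 < k)%N ->
    cvgn (fun n => perm_density R tau (sigma n)).

(* Functions on [0, 1] are total functions on [R] whose values outside [0, 1]
   are irrelevant. *)
Definition is_cdf (R : realType) (F : R -> R) : Prop :=
  [/\ F 0 = 0,
      forall x, x \in `[0, 1] -> F x \in `[0, 1],
      {in `[0, 1] &, {homo F : x y / x <= y}} &
      forall x, x \in `]0, 1] -> F y @[y --> x^'-] --> F x].

(* A Borel measure on [0, 1] is a measure on [R] carried by [0, 1]. *)
Definition is_cdf_measure (R : realType) (F : R -> R)
    (P : probability (measurableTypeR R) R) : Prop :=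
  P `[0, 1]%classic = 1%E /\
  forall a b : R, 0 <= a -> a < b -> b <= 1 ->
    P `[a, b[%classic = (F b - F a)%:E.

Section cdf_measure_exists.
Context (R : realType) (F : R -> R) (cdfF : is_cdf F).

(* A right-continuous reflection of [F]; the measure sought is the image under
   [x |-> 1 - x] of its Lebesgue-Stieltjes measure. *)
Let G (t : R) : R := if t < 0 then 0 else if 1 <= t then 1 else 1 - F (1 - t).

Let G_nd : nondecreasing G.
Proof.
have [F0 F01 Fnd _] := cdfF.
have F1 t : 0 <= t -> t < 1 -> 0 <= 1 - F (1 - t) <= 1.
  move=> t0 t1; have : 1 - t \in `[0, 1] by rewrite in_itv/=; lra.
  by move=> /F01; rewrite in_itv/=; lra.
move=> x y xy; rewrite /G.
case: (ltP x 0) => x0; case: (ltP y 0) => y0; rewrite ?lexx//.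
- by case: (leP 1 y) => y1; [rewrite ler01|case/andP: (F1 _ y0 y1)].
- lra.
- case: (leP 1 x) => x1; case: (leP 1 y) => y1; rewrite ?lexx//.
  + lra.
  + by case/andP: (F1 _ x0 x1).
  + by rewrite lerD2l lerN2; apply: Fnd; rewrite ?in_itv/=; lra.
Qed.

Let G_rc : right_continuous G.
Proof.
have [F0 F01 Fnd Flc] := cdfF.
move=> a; rewrite /G; case: (ltP a 0) => a0.
  apply: (@cvg_near_cst _ (R : topologicalType)); near=> x.
  suff -> : x < 0 by [].
  by near: x; exact: nbhs_right_lt.
case: (leP 1 a) => a1.
  apply: (@cvg_near_cst _ (R : topologicalType)); near=> x.
  have ax : a < x by [].
  by rewrite ltNge !(le_trans _ (ltW ax)).
have /Flc/cvgrPdist_lt H : 1 - a \in `]0, 1] by rewrite in_itv/=; lra.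
apply/cvgrPdist_lt => e e0.
have [d d0 Hd] := H e e0.
near=> x.
have ax : a < x by [].
have x1 : x < 1 by near: x; exact: nbhs_right_lt.
have xd : x < a + d by near: x; apply: nbhs_right_lt; rewrite ltrDl.
rewrite [x < 0]ltNge (le_trans a0 (ltW ax)) /= leNgt x1 /=.
have -> : 1 - F (1 - a) - (1 - F (1 - x)) = - (F (1 - a) - F (1 - x)) by lra.
rewrite normrN; apply: Hd => /=; last lra.
have -> : 1 - a - (1 - x) = x - a by lra.
by rewrite gtr0_norm; lra.
Unshelve. all: by end_near. Qed.

#[local] HB.instance Definition _ := isCumulative.Build R _ R G G_nd G_rc.

Let G_Ny : G @ -oo --> (0 : R).
Proof.
apply: (@cvg_near_cst _ (R : topologicalType)); near=> x.
by rewrite /G; suff -> : x < 0 by []; near: x; exact: nbhs_ninfty_lt.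
Unshelve. all: by end_near. Qed.

Let G_y : G @ +oo --> (1 : R).
Proof.
apply: (@cvg_near_cst _ (R : topologicalType)); near=> x.
have x1 : 1 <= x by near: x; exact: nbhs_pinfty_ge.
by rewrite /G x1 ltNge (le_trans ler01).
Unshelve. all: by end_near. Qed.

#[local] HB.instance Definition _ :=
  isCumulativeBounded.Build R 0 1 G G_Ny G_y.

Let nu : probability (measurableTypeR R) R := lebesgue_stieltjes_measure G.

Let refl (x : measurableTypeR R) : measurableTypeR R := 1 - x.

Let mrefl : measurable_fun setT refl.
Proof.
apply: (@continuous_measurable_fun R refl) => x.
by apply: cvgB; [exact: cvg_cst|exact: cvg_id].
Qed.

#[local] HB.instance Definition _ :=
  @isMeasurableFun.Build _ _ _ _ refl mrefl.

Let P : probability (measurableTypeR R) R :=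
  distribution nu (refl : {mfun _ >-> _}).

Lemma is_cdf_measure_exists : exists P, @is_cdf_measure R F P.
Proof.
have [F0 F01 _ _] := cdfF.
have PE a b : a <= b -> P `[a, b[%classic = (G (1 - a) - G (1 - b))%:E.
  move=> ab.
  have -> : P `[a, b[%classic = nu `]1 - b, 1 - a]%classic.
    rewrite /P /distribution /pushforward; congr (nu _).
    have E (x : R) : (a <= 1 - x < b) = (1 - b < x <= 1 - a).
      by apply/idP/idP; lra.
    by apply/seteqP; split=> x; rewrite /= !in_itv/= /refl E.
  rewrite /nu/= /lebesgue_stieltjes_measure /measure_extension/=.
  by rewrite measurable_mu_extE/=; [rewrite wlength_itv_bnd// lerD2l lerN2
                                  |exact: is_ocitv].
exists P; split; last first.
  move=> a b a0 ab b1; rewrite PE ?ltW// /G.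
  have -> : (1 - a < 0) = false by apply: le_gtF; lra.
  have -> : (1 - b < 0) = false by apply: le_gtF; lra.
  have -> : (1 <= 1 - b) = false by apply: lt_geF; lra.
  have -> : 1 - (1 - b) = b by lra.
  have -> : 1 - (1 - a) = a by lra.
  case: ifP => a1; last by congr (_%:E); lra.
  have -> : a = 0 by lra.
  by rewrite F0; congr (_%:E); lra.
have -> : `[0, 1]%classic =
    \bigcap_(k : nat) `[(0 : R), 1 + k.+1%:R^-1[%classic.
  apply/seteqP; split=> x /=; rewrite in_itv/=.
    move=> /andP[x0 x1] k _ /=; rewrite in_itv/= x0/=.
    by rewrite (le_lt_trans x1)// ltrDl invr_gt0 ltr0n.
  move=> H; have /andP[-> _] : 0 <= x < 1 + 1%:R^-1.
    by have := H 0%N I; rewrite /= in_itv.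
  apply/ler_addgt0Pr => e e0; near \oo => k.
  have := H k I; rewrite /= in_itv/= => /andP[_ /ltW/le_trans]; apply.
  rewrite lerD2l ltW//; near: k; exact: near_infty_natSinv_lt (PosNum e0).
set D := fun k : nat => _.
have : (P \o D) @ \oo --> P (\bigcap_k D k).
  apply: nonincreasing_cvg_mu.
  - by rewrite (le_lt_trans (probability_le1 _ _)) ?ltry//;
      exact: measurable_itv.
  - by move=> k; exact: measurable_itv.
  - by apply: bigcapT_measurable => k; exact: measurable_itv.
  - move=> m n mn; apply/subsetPset => x; rewrite /D/= !in_itv/=.
    move=> /andP[-> /=].
    move=> /lt_le_trans; apply.
    by rewrite lerD2l lef_pV2 ?posrE ?ltr0n// ler_nat.
suff -> : P \o D = cst 1%E by move/cvg_lim => <-//; rewrite lim_cst.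
apply/funext => k /=.
have k0 : 0 < k.+1%:R^-1 :> R by rewrite invr_gt0 ltr0n.
transitivity (G (1 - 0) - G (1 - (1 + k.+1%:R^-1)))%:E.
  by apply: PE; rewrite addr_ge0// ltW.
rewrite /G; have -> : (1 - 0 < 0 :> R) = false by apply: le_gtF; lra.
have -> : 1 <= 1 - 0 :> R by lra.
by rewrite opprD addrA subrr sub0r oppr_lt0 k0 subr0.
Unshelve. all: by end_near. Qed.

End cdf_measure_exists.

Lemma is_cdf_measure_unique (R : realType) (F : R -> R)
    (P Q : probability (measurableTypeR R) R) (A : set (measurableTypeR R)) :
  is_cdf_measure F P -> is_cdf_measure F Q -> measurable A -> P A = Q A.
Proof.
move=> [P1 PF] [Q1 QF].
have null (S : probability (measurableTypeR R) R)
    (B : set (measurableTypeR R)) :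
    S `[0, 1]%classic = 1%E -> measurable B -> B `&` `[0, 1]%classic = set0 ->
    S B = 0%E.
  move=> S1 mB B01.
  have SC : S (~` `[0, 1]%classic) = 0%E.
    by rewrite probability_setC ?S1 ?subee//; exact: measurable_itv.
  apply/eqP; rewrite eq_le measure_ge0 andbT -SC; apply: le_measure.
  - by rewrite inE.
  - by rewrite inE; apply: measurableC; exact: measurable_itv.
  - by apply/disjoints_subset.
have full (S : probability (measurableTypeR R) R)
    (B : set (measurableTypeR R)) :
    S `[0, 1]%classic = 1%E -> measurable B -> `[0, 1]%classic `<=` B ->
    S B = 1%E.
  move=> S1 mB B01.
  apply/eqP; rewrite eq_le probability_le1//= -S1; apply: le_measure => //.
  - by rewrite inE; exact: measurable_itv.
  - by rewrite inE.
move=> mA.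
apply: (@measure_unique _ R (measurableTypeR R) (@RGenInftyO.G R)
  (fun n => `]-oo, n%:R[%classic) _ _ _ _ P Q) => //.
- exact: RGenInftyO.measurableE.
- move=> _ _ [x ->] [y ->]; exists (Num.min x y).
  by apply/seteqP; split=> z; rewrite /= !in_itv/= lt_min;
    [case=> -> ->|case/andP].
- by move=> n; exists n%:R.
- rewrite -subTset => x _; exists (Num.bound `|x|) => //=.
  rewrite in_itv/=; apply: (le_lt_trans (ler_norm x)).
  exact: archi_boundP.
- move=> _ [b ->].
  have D (c : R) : c <= 0 -> `]-oo, c[%classic `&` `[0, 1]%classic = set0.
    move=> c0; rewrite -subset0 => x /= []; rewrite !in_itv/= => xc /andP[x0 _].
    by have := lt_le_trans xc c0; rewrite ltNge x0.
  have [b0|b0] := leP b 0.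
    by transitivity (0%E : \bar R);
      [apply: (null P _ P1)|apply/esym/(null Q _ Q1)];
      do ?[exact: D|exact: measurable_itv].
  have [b1|b1] := ltP 1 b.
    have fullb : `[0, 1]%classic `<=` `]-oo, b[%classic.
      by move=> x /=; rewrite !in_itv/= => /andP[_ /le_lt_trans]; apply.
    by transitivity (1%E : \bar R);
      [apply: (full P _ P1)|apply/esym/(full Q _ Q1)] => //;
      exact: measurable_itv.
  have -> : `]-oo, b[%classic = `]-oo, 0[%classic `|` `[0, b[%classic :> set R.
    apply/seteqP; split=> x /=; rewrite !in_itv/=.
      by move=> xb; have [x0|x0] := ltP x 0; [left|right].
    by case=> [/lt_trans|/andP[]//]; apply.
  have dis : `]-oo, 0[%classic `&` `[0, b[%classic = set0 :> set R.
    rewrite -subset0 => x /= []; rewrite !in_itv/= => x0 /andP[].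
    by rewrite leNgt x0.
  have ub (S : probability (measurableTypeR R) R) : is_cdf_measure F S ->
      S (`]-oo, 0[%classic `|` `[0, b[%classic) = (F b - F 0)%:E.
    move=> [S1 SF]; rewrite measureU//; do ?exact: measurable_itv.
    rewrite -[RHS]add0e; congr (_ + _)%E; last exact: SF.
    by apply: (null S _ S1); [exact: measurable_itv|exact: D].
  by transitivity ((F b - F 0)%:E); [exact: (ub P)|apply/esym/(ub Q)].
- move=> k; rewrite (le_lt_trans (probability_le1 _ _))// ?ltry//.
Qed.

(* By [cdf_measureP] and [is_cdf_measure_unique], the default value [\d_0] is
   never used when [F] is a cdf, and the choice is immaterial. *)
Definition cdf_measure (R : realType) (F : R -> R) :
    probability (measurableTypeR R) R :=
  if pselect (exists P, @is_cdf_measure R F P) is left ex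
  then projT1 (cid ex) else \d_(0 : measurableTypeR R).

Lemma cdf_measureP (R : realType) (F : R -> R) :
  is_cdf F -> is_cdf_measure F (cdf_measure F).
Proof.
move=> /is_cdf_measure_exists ex; rewrite /cdf_measure.
by case: pselect => [ex'|//]; exact: (projT2 (cid ex')).
Qed.

Definition rect_dist (R : realType) (Z1 Z2 : R -> R -> R) : \bar R :=
  ereal_sup [set e | exists x1 x2 a1 a2 : R,
    [/\ 0 <= x1, x1 < x2 & x2 <= 1] /\ [/\ 0 <= a1, a1 < a2 & a2 <= 1] /\
    e = (`| \int[lebesgue_measure]_(x in `[x1, x2])
              cdf_measure (Z1 x) `[a1, a2]%classic
          - \int[lebesgue_measure]_(x in `[x1, x2])
              cdf_measure (Z2 x) `[a1, a2]%classic |)%E].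

(* For x in ]0, 1] there is exactly one [i] with [i.+1 = ceil (n x)], so the
   last case is the indicator of sigma(ceil (n x)) < ceil (n y). *)
Definition perm_step (R : realType) n (sigma : 'S_n) (x y : R) : R :=
  if y == 0 then 0
  else if x == 0 then (Num.ceil (n%:R * y))%:~R / n%:R
  else [exists i : 'I_n, ((i.+1)%:Z == Num.ceil (n%:R * x)) &&
                         ((sigma i).+1%:Z < Num.ceil (n%:R * y))]%:R.

Arguments perm_step R {n} sigma x y.

Lemma perm_step_is_cdf (R : realType) n (sigma : 'S_n) (x : R) :
  (0 < n)%N -> is_cdf (perm_step R sigma x).
Proof.
move=> n0; have n0' : 0 < n%:R :> R by rewrite ltr0n.
pose h (c : int) : R := if x == 0 then c%:~R / n%:R
  else [exists i : 'I_n, ((i.+1)%:Z == Num.ceil (n%:R * x)) &&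
                         ((sigma i).+1%:Z < c)]%:R.
have stepE y : 0 < y -> perm_step R sigma x y = h (Num.ceil (n%:R * y)).
  by move=> y0; rewrite /perm_step gt_eqF.
have step0 : perm_step R sigma x 0 = 0 by rewrite /perm_step eqxx.
have h_nd : {homo h : c d / (c <= d)%R >-> (c <= d)%R}.
  move=> c d cd; rewrite /h; case: ifP => _.
    by rewrite ler_pM2r ?invr_gt0// ler_int.
  rewrite ler_nat; case: existsP => // -[i /andP[ix ic]].
  suff -> : [exists i : 'I_n, ((i.+1)%:Z == Num.ceil (n%:R * x)) &&
                              ((sigma i).+1%:Z < d)] by [].
  by apply/existsP; exists i; rewrite ix (lt_le_trans ic cd).
have h01 c : 0 <= c -> c <= n%:Z -> 0 <= h c <= 1.
  move=> c0 cn; rewrite /h; case: ifP => _.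
    rewrite divr_ge0 ?ler0z ?ler0n//= ler_pdivrMr// mul1r.
    by rewrite -[n%:R]/(n%:Z%:~R) ler_int.
  by case: [exists _, _]; rewrite ?lexx ?ler01.
have h01y (y : R) : 0 < y -> y <= 1 -> 0 <= h (Num.ceil (n%:R * y)) <= 1.
  move=> y0 y1; apply: h01.
    by rewrite ceil_ge0 (lt_le_trans (ltrN10 R))// mulr_ge0 ?ltW.
  by rewrite ceil_le_int// -[n%:~R]/(n%:R) -[leRHS]mulr1 ler_pM2l.
have step_ge0 y : 0 <= y -> y <= 1 -> 0 <= perm_step R sigma x y <= 1.
  rewrite le_eqVlt => /predU1P[<- _|y0 y1]; first by rewrite step0 lexx ler01.
  by rewrite stepE// h01y.
split => //.
- by move=> y; rewrite !in_itv/= => /andP[]; exact: step_ge0.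
- move=> y z; rewrite !in_itv/= => /andP[y0 y1] /andP[z0 z1] yz.
  move: y0; rewrite le_eqVlt => /predU1P[<-|y0].
    by rewrite step0; case/andP: (step_ge0 z z0 z1).
  have {}z0 := lt_le_trans y0 yz.
  by rewrite !stepE//; apply: h_nd; rewrite le_ceil// ler_pM2l.
- move=> y; rewrite in_itv/= => /andP[y0 y1].
  apply: (@cvg_near_cst _ (R : topologicalType)); near=> z.
  have z0 : 0 < z by near: z; exact: nbhs_left_gt.
  have zy : z < y by [].
  rewrite !stepE//; congr h; apply/eqP; rewrite eq_le.
  apply/andP; split; first by rewrite le_ceil// ler_wpM2l// ltW.
  have : n%:R * z > (Num.ceil (n%:R * y) - 1)%:~R.
    rewrite -ltr_pdivrMl//; near: z; apply: nbhs_left_gt.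
    by rewrite ltr_pdivrMl//; exact: ceilB1_lt.
  by rewrite -ceil_gt_int ltrBlDr ltzD1.
Unshelve. all: by end_near. Qed.

Definition perm_rect_dist (R : realType) m n (sigma : 'S_m) (pi : 'S_n) :
    \bar R :=
  rect_dist (perm_step R sigma) (perm_step R pi).

Definition rect_cauchy (R : realType) (len : nat -> nat)
    (sigma : forall n, 'S_(len n)) : Prop :=
  forall eps : R, 0 < eps -> exists n0 : nat, forall n m : nat,
    (n0 <= n)%N -> (n0 <= m)%N ->
    (perm_rect_dist R (sigma n) (sigma m) < eps%:E)%E.

(* Main.v *)
Require Import Defs.
From mathcomp Require Import all_boot all_order all_algebra perm.
From mathcomp Require Import all_classical all_reals all_analysis.
From mathcomp Require Import measurable_realfun ring lra.

(** A permutation [s] of [[n]] is treated as the uniform distribution on its graph,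
    rescaled to the unit square. Let [corner s a b] be the mass that it gives to
    [[0, a] x [0, b]]. If the lengths tend to infinity, both properties of the
    theorem say that these distribution functions are uniformly Cauchy.

    For the rectangular distance this is a computation. The fibre measures of the step
    function of [s] are Dirac masses, so that an integral over a box is the mass of
    the box, up to [O(1/n)] from the two blocks cut by its vertical sides
    ([rect_mass_close]); and the mass of a box is a signed sum of four corners
    ([box_diff]).

    If the corners of [s] and [p] are close, so are the pattern frequencies, that is,
    the probabilities that k independent random points form a given pattern
    ([pattern_freq_diff]): exchange the points one at a time. When all points but one
    are fixed, the admissible positions of the last one form a box, on which the two
    distributions nearly agree. Frequencies and densities differ only through
    repeated points, by a factor that converges.

    Conversely, let all pattern densities converge. Then so does the probability of
    every event that depends only on the order type of finitely many random points
    ([cvgn_order_event]). A grid point of abscissa [x] lies weakly to the right of an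
    independent random point with probability [x], so the moments [E(x^a y^b)]
    are such probabilities ([graph_avg_moment]) and converge; hence so do the
    expectations of all products [P(x) Q(y)] of polynomials. Bernstein polynomials
    approximate the indicator of [x <= a] outside a small neighbourhood of [a], which
    has small mass because the marginals are uniform on the grid. The
    approximation is uniform in [a] and uses finitely many polynomials, so the
    corners are uniformly Cauchy ([corner_close_bern]).

    If the lengths do not tend to infinity, some permutation occurs infinitely
    often ([len_infty_or_recurrent]), and each of the two properties makes the sequence
    eventually equal to it: a permutation is isolated for the rectangular distance
    ([rect_dist_rigid]), and the densities of the patterns of length k and k+1 recognise
    a permutation of length k. *)

Set Implicit Arguments.
Unset Strict Implicit.
Unset Printing Implicit Defensive.

Import Order.TTheory GRing.Theory Num.Theory.
Import numFieldNormedType.Exports.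

Local Open Scope classical_set_scope.
Local Open Scope ring_scope.

(** * Averages over the graph of a permutation *)

Section GraphAverages.
Context {R : realType}.
Implicit Types (x y a b c : R) (phi psi : R -> R -> R).

Definition gridpt n (i : 'I_n) : R := i.+1%:R / n%:R.

(** The graph of [s], rescaled to the unit square and carrying the uniform
    distribution, is the atomic measure that stands for [s]; this is the
    expectation with respect to it. *)
Definition graph_avg n (s : 'S_n) phi : R :=
  (\sum_(i < n) phi (gridpt i) (gridpt (s i))) / n%:R.

(** The bivariate distribution function of that measure. *)
Definition corner n (s : 'S_n) a b : R :=
  graph_avg s (fun x y => ((x <= a) && (y <= b))%:R).

Lemma gridpt_gt0 n (i : 'I_n) : 0 < gridpt i.
Proof. by rewrite divr_gt0 ?ltr0n// (leq_trans _ (ltn_ord i)). Qed.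

Lemma gridpt_le1 n (i : 'I_n) : gridpt i <= 1.
Proof.
by rewrite ler_pdivrMr ?ltr0n ?(leq_trans _ (ltn_ord i))// mul1r ler_nat.
Qed.

Lemma ler_gridpt n (i j : 'I_n) : (gridpt i <= gridpt j) = (i <= j)%N.
Proof.
have n0 : (0 < n)%N by exact: leq_trans (ltn_ord i).
by rewrite ler_pM2r ?invr_gt0 ?ltr0n// ler_nat.
Qed.

Lemma ltr_gridpt n (i j : 'I_n) : (gridpt i < gridpt j) = (i < j)%N.
Proof. by rewrite ltNge ler_gridpt -ltnNge. Qed.

Lemma graph_avgB n (s : 'S_n) phi psi :
  graph_avg s (fun x y => phi x y - psi x y) = graph_avg s phi - graph_avg s psi.
Proof. by rewrite /graph_avg sumrB mulrBl. Qed.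

Lemma graph_avgD n (s : 'S_n) phi psi :
  graph_avg s (fun x y => phi x y + psi x y) = graph_avg s phi + graph_avg s psi.
Proof. by rewrite /graph_avg big_split mulrDl. Qed.

Lemma graph_avgZ n (s : 'S_n) c phi :
  graph_avg s (fun x y => c * phi x y) = c * graph_avg s phi.
Proof. by rewrite /graph_avg -mulr_sumr mulrA. Qed.

Lemma graph_avg_sum n (s : 'S_n) (I : finType) (F : I -> R -> R -> R) :
  graph_avg s (fun x y => \sum_i F i x y) = \sum_i graph_avg s (F i).
Proof. by rewrite /graph_avg exchange_big mulr_suml. Qed.

Lemma eq_graph_avg n (s : 'S_n) phi psi :
  (forall x y, 0 < x <= 1 -> 0 < y <= 1 -> phi x y = psi x y) ->
  graph_avg s phi = graph_avg s psi.
Proof.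
move=> eqphi; rewrite /graph_avg; congr (_ / _); apply: eq_bigr => i _.
by apply: eqphi; rewrite gridpt_gt0 gridpt_le1.
Qed.

Lemma le_graph_avg n (s : 'S_n) phi psi :
  (forall x y, 0 < x <= 1 -> 0 < y <= 1 -> phi x y <= psi x y) ->
  graph_avg s phi <= graph_avg s psi.
Proof.
move=> lephi; rewrite /graph_avg; apply: ler_wpM2r; first by rewrite invr_ge0 ler0n.
by apply: ler_sum => i _; apply: lephi; rewrite gridpt_gt0 gridpt_le1.
Qed.

Lemma ler_norm_graph_avg n (s : 'S_n) phi :
  `|graph_avg s phi| <= graph_avg s (fun x y => `|phi x y|).
Proof.
rewrite /graph_avg normrM normfV normr_nat.
by apply: ler_wpM2r; [rewrite invr_ge0 ler0n|exact: ler_norm_sum].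
Qed.

Lemma graph_avg_cst n (s : 'S_n) c :
  (0 < n)%N -> graph_avg s (fun _ _ => c) = c.
Proof.
move=> n0; rewrite /graph_avg sumr_const card_ord -[c *+ n]mulr_natr mulfK//.
by rewrite pnatr_eq0 -lt0n.
Qed.

Lemma graph_avg_snd n (s : 'S_n) (f : R -> R) :
  graph_avg s (fun _ y => f y) = graph_avg s (fun x _ => f x).
Proof.
by rewrite /graph_avg; congr (_ / _); apply/esym/(reindex_inj (@perm_inj _ s)).
Qed.

(** The grid points equidistribute: their distribution function is [floor (n a) / n]. *)
Lemma grid_cdf_bounds n (s : 'S_n) a : (0 < n)%N -> 0 <= a <= 1 ->
  a - n%:R^-1 <= graph_avg s (fun x _ => (x <= a)%R%:R) <= a.
Proof.
move=> n0 /andP[a0 a1]; have n0' : 0 < n%:R :> R by rewrite ltr0n.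
have na0 : 0 <= n%:R * a by rewrite mulr_ge0 ?ler0n.
set k := Num.truncn (n%:R * a).
have /andP[k_le k_gt] := truncn_itv na0; rewrite -/k in k_le k_gt.
have kn : (k <= n)%N by rewrite -(ler_nat R) (le_trans k_le)// ler_piMr ?ler0n.
have -> : graph_avg s (fun x _ => (x <= a)%R%:R) = k%:R / n%:R.
  congr (_ / _); rewrite -natr_sum; congr _%:R.
  transitivity (\sum_(i < n) (i < k)%N)%N.
    apply: eq_bigr => i _; congr nat_of_bool.
    by rewrite /gridpt ler_pdivrMr// mulrC -truncn_ge_nat.
  rewrite -(big_mkord xpredT (fun i => (i < k)%N : nat)) (big_cat_nat (leq0n k) kn)//=.
  have -> : (\sum_(k <= i < n) (i < k) = 0)%N.
    by apply: big1_seq => i; rewrite mem_index_iota => /andP[_ /andP[ki _]]; rewrite ltnNge ki.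
  rewrite (eq_big_nat _ _ (F2 := fun=> 1%N)) => [|i /andP[_ ->]//].
  by rewrite sum_nat_const_nat muln1 subn0 addn0.
rewrite ler_pdivrMr// [a * _]mulrC k_le andbT ler_pdivlMr// mulrBl mulVf ?gt_eqF//.
by rewrite lerBlDr natr1 mulrC ltW.
Qed.

Definition down_closed (d : pred R) := forall x y, x <= y -> d y -> d x.

Lemma down_closed_le a : down_closed (fun x => x <= a).
Proof. by move=> x y; exact: le_trans. Qed.

Lemma down_closed_lt a : down_closed (fun x => x < a).
Proof. by move=> x y; exact: le_lt_trans. Qed.

Lemma down_closedI (d e : pred R) :
  down_closed d -> down_closed e -> down_closed (fun x => d x && e x).
Proof. by move=> dd de x y xy /andP[/(dd _ _ xy)-> /(de _ _ xy)->]. Qed.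

(** Only finitely many abscissae matter, so that strict, weak and vacuous
    upper bounds can all be traded for a weak bound in [[0, 1]], the same for two
    permutations. *)
Lemma down_closed_cutoff (d : pred R) (xs : seq R) :
  {in xs, forall x, 0 < x <= 1} -> down_closed d ->
  exists2 c, 0 <= c <= 1 & {in xs, forall x, d x = (x <= c)}.
Proof.
move=> xs01 dd; pose c := \big[Num.max/0]_(x <- xs | d x) x.
have c0 : 0 <= c.
  rewrite /c big_seq_cond; elim/big_ind: _ => // [x y x0 _|x].
    by rewrite le_max x0.
  by move=> /andP[/xs01/andP[/ltW]].
exists c.
  rewrite c0/= /c big_seq_cond; elim/big_ind: _ => // [x y x1 y1|x].
    by rewrite ge_max x1.
  by move=> /andP[/xs01/andP[]].
move=> x xxs; apply/idP/idP => [dx|]; first by rewrite /c; apply: le_bigmax_seq.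
apply: contraTT => ndx; rewrite -ltNge /c; elim/big_ind: _.
- by case/andP: (xs01 _ xxs).
- by move=> y z yx zx; rewrite gt_max yx.
- by move=> y dy; rewrite ltNge; apply: contra ndx => /dd; exact.
Qed.

Definition corner_close m n (s : 'S_m) (p : 'S_n) (e : R) :=
  forall a b, 0 <= a <= 1 -> 0 <= b <= 1 -> `|corner s a b - corner p a b| <= e.

Lemma down_closed_diff m n (s : 'S_m) (p : 'S_n) e (d1 d2 : pred R) :
  corner_close s p e -> down_closed d1 -> down_closed d2 ->
  `|graph_avg s (fun x y => (d1 x && d2 y)%:R)
    - graph_avg p (fun x y => (d1 x && d2 y)%:R)| <= e.
Proof.
move=> sp dd1 dd2.
pose xs := [seq gridpt i | i : 'I_m] ++ [seq gridpt i | i : 'I_n].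
have xs01 : {in xs, forall x, 0 < x <= 1}.
  by move=> x; rewrite mem_cat => /orP[] /mapP[i _ ->]; rewrite gridpt_gt0 gridpt_le1.
have xsl (i : 'I_m) : gridpt i \in xs by rewrite mem_cat map_f// mem_enum.
have xsr (i : 'I_n) : gridpt i \in xs by rewrite mem_cat orbC map_f// mem_enum.
have [a a01 aE] := down_closed_cutoff xs01 dd1.
have [b b01 bE] := down_closed_cutoff xs01 dd2.
have := sp _ _ a01 b01; rewrite /corner /graph_avg.
under eq_bigr do rewrite -aE// -bE//.
by under [X in _ - X / _]eq_bigr do rewrite -aE// -bE//.
Qed.

(** Inclusion and exclusion over the four corners of a box; the box may contain or
    miss any part of its boundary. *)
Lemma box_diff m n (s : 'S_m) (p : 'S_n) e (d1 e1 d2 e2 : pred R) :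
  corner_close s p e ->
  down_closed d1 -> down_closed e1 -> down_closed d2 -> down_closed e2 ->
  `|graph_avg s (fun x y => [&& d1 x, ~~ e1 x, d2 y & ~~ e2 y]%:R)
    - graph_avg p (fun x y => [&& d1 x, ~~ e1 x, d2 y & ~~ e2 y]%:R)| <= 4 * e.
Proof.
move=> sp dd1 de1 dd2 de2.
pose f1 x := d1 x && e1 x; pose f2 x := d2 x && e2 x.
have df1 : down_closed f1 by exact: down_closedI.
have df2 : down_closed f2 by exact: down_closedI.
have boxE k (q : 'S_k) :
    graph_avg q (fun x y => [&& d1 x, ~~ e1 x, d2 y & ~~ e2 y]%:R) =
    (graph_avg q (fun x y => (d1 x && d2 y)%:R) -
     graph_avg q (fun x y => (f1 x && d2 y)%:R)) -
    (graph_avg q (fun x y => (d1 x && f2 y)%:R) -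
     graph_avg q (fun x y => (f1 x && f2 y)%:R)).
  rewrite -!graph_avgB; apply: eq_graph_avg => x y _ _; rewrite /f1 /f2.
  by case: (d1 x); case: (e1 x); case: (d2 y); case: (e2 y) => /=; ring.
rewrite !boxE.
have := down_closed_diff sp dd1 dd2; have := down_closed_diff sp df1 dd2.
have := down_closed_diff sp dd1 df2; have := down_closed_diff sp df1 df2.
by rewrite !ler_norml => /andP[? ?] /andP[? ?] /andP[? ?] /andP[? ?]; lra.
Qed.

End GraphAverages.

(** * Rectangular integrals as sums over the graph *)

Section Bridge.
Context {R : realType}.
Implicit Types (x y a b : R).
Local Notation mu := (@lebesgue_measure R).

(** For [x >= 0], the length of the part of the i-th grid block that lies to the left
    of [x]. *)
Definition overlap n (i : 'I_n) x : R :=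
  Num.min x (gridpt i) - Num.min x (i%:R / n%:R).

Lemma gridptE n (i : 'I_n) : gridpt i = i%:R / n%:R + n%:R^-1 :> R.
Proof. by rewrite /gridpt -natr1 mulrDl mul1r. Qed.

Lemma cdf_measure_perm_step n (s : 'S_n) (i : 'I_n) x (A : set (measurableTypeR R)) :
  i%:R / n%:R < x <= gridpt i -> measurable A ->
  cdf_measure (perm_step R s x) A = \d_(gridpt (s i) : measurableTypeR R) A.
Proof.
move=> /andP[ix xi] mA.
have n0 : (0 < n)%N by exact: leq_trans (ltn_ord i).
have n0' : 0 < n%:R :> R by rewrite ltr0n.
have x0 : 0 < x by rewrite (le_lt_trans _ ix)// divr_ge0.
have cx : Num.ceil (n%:R * x) = i.+1%:Z.
  apply: ceil_def; apply/andP; split.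
    by rewrite intS addrC addKr mulrC -ltr_pdivrMr.
  by rewrite mulrC -ler_pdivlMr.
have stepE y : 0 <= y -> perm_step R s x y = (gridpt (s i) < y)%R%:R.
  move=> y0; rewrite /perm_step (gt_eqF x0).
  case: eqP => [->|_]; first by rewrite le_gtF// ltW// gridpt_gt0.
  congr (nat_of_bool _)%:R; rewrite cx.
  have -> : (gridpt (s i) < y) = ((s i).+1%:Z < Num.ceil (n%:R * y)).
    by rewrite ceil_gt_int /gridpt ltr_pdivrMr// mulrC.
  apply/existsP/idP => [[j /andP[/eqP[ji]]]|si]; last by exists i; rewrite eqxx.
  by have -> : j = i by exact/val_inj.
pose P : probability (measurableTypeR R) R := \d_(gridpt (s i) : measurableTypeR R).
have PE (C : set (measurableTypeR R)) : P C = (gridpt (s i) \in C)%:R%:E.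
  exact: diracE.
suff cdfP : is_cdf_measure (perm_step R s x) P.
  exact: (is_cdf_measure_unique (cdf_measureP (perm_step_is_cdf s x n0)) cdfP).
split; first by rewrite PE mem_set//= in_itv/= gridpt_le1 ltW// gridpt_gt0.
move=> a b a0 ab b1; have b0 : 0 <= b by exact: le_trans (ltW ab).
rewrite !stepE// PE.
have -> : (gridpt (s i) \in `[a, b[%classic) = (a <= gridpt (s i) < b).
  by apply/idP/idP => [/set_mem|?]; [|apply/mem_set]; rewrite /= in_itv.
case: (ltP (gridpt (s i)) a) => sa /=.
  by rewrite (lt_trans sa ab) subrr.
by rewrite subr0.
Qed.

Lemma overlap_diff (l d x1 x2 : R) : 0 < d -> x1 < x2 ->
  (Num.min x2 (l + d) - Num.min x2 l) - (Num.min x1 (l + d) - Num.min x1 l) =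
  if Num.max l x1 < Num.min (l + d) x2 then Num.min (l + d) x2 - Num.max l x1 else 0.
Proof.
move=> d0 x12; rewrite maxC [Num.min (l + d) x2]minC /Num.max /Num.min.
by case: (ltP x2 (l + d)); case: (ltP x2 l); case: (ltP x1 (l + d));
  case: (ltP x1 l) => *; case: ltP => *; lra.
Qed.

(** The measure that the step function of [s] describes is that of the graph, with
    every atom smeared out horizontally over its block; this is its mass on a box. *)
Definition rect_mass n (s : 'S_n) x1 x2 a b : R :=
  \sum_(i < n) (overlap i x2 - overlap i x1) * (a <= gridpt (s i) <= b)%R%:R.

(** The fibre measure is constant, a single Dirac mass, on every block of abscissae;
    the abscissa 0 belongs to no block but is negligible. *)
Lemma perm_step_integral n (s : 'S_n) x1 x2 a b : (0 < n)%N ->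
  0 <= x1 -> x1 < x2 -> x2 <= 1 ->
  (\int[mu]_(x in `[x1, x2]) cdf_measure (perm_step R s x) `[a, b]%classic =
  (rect_mass s x1 x2 a b)%:E)%E.
Proof.
move=> n0 x10 x12 x21; have n0' : 0 < n%:R :> R by rewrite ltr0n.
pose B (i : 'I_n) : set R := `]i%:R / n%:R, gridpt i]%classic.
pose c (i : 'I_n) : R := (a <= gridpt (s i) <= b)%R%:R.
pose h (x : R) : \bar R := (\sum_(i <- enum 'I_n) (c i)%:E * (\1_(B i) x)%:E)%E.
have c0 i : 0 <= c i by rewrite ler0n.
have mB i : measurable (B i) by exact: measurable_itv.
have mh1 i : measurable_fun setT (fun x : measurableTypeR R => (\1_(B i) x)%:E).
  by apply/measurable_EFinP; apply: measurable_indic; exact: mB.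
have mh i : measurable_fun setT
    (fun x : measurableTypeR R => (c i)%:E * (\1_(B i) x)%:E)%E.
  by apply: measurable_funeM; exact: mh1.
have hE x : 0 < x <= 1 -> cdf_measure (perm_step R s x) `[a, b]%classic = h x.
  move=> /andP[x0 xle1].
  have := ceil_itv (n%:R * x).
  have : 0 < Num.ceil (n%:R * x) by rewrite ceil_gt0 mulr_gt0.
  have : Num.ceil (n%:R * x) <= n%:Z by rewrite ceil_le_int ler_piMr ?ler0n.
  case: (Num.ceil _) => [[//|j]|//] jn _ xj.
  pose i := Ordinal (jn : (j < n)%N).
  have xi : i%:R / n%:R < x <= gridpt i.
    rewrite ltr_pdivrMr// ler_pdivlMr// [x * _]mulrC.
    by move: xj; rewrite intS addrC addKr.
  rewrite (cdf_measure_perm_step s xi (measurable_itv _)) diracE /h.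
  rewrite big_enum/= (bigD1 i)//= big1 ?adde0; last first.
    move=> k ki; rewrite indicE memNset ?mule0// /B /= in_itv/= => /andP[kx xk].
    move/andP: xi => [ix xi]; move/eqP: ki; apply; apply: val_inj => /=.
    have lt1 : (i < k.+1)%N.
      have := lt_le_trans ix xk; rewrite /gridpt.
      by rewrite ltr_pM2r ?invr_gt0// ltr_nat.
    have lt2 : (k < i.+1)%N.
      have := lt_le_trans kx xi; rewrite /gridpt.
      by rewrite ltr_pM2r ?invr_gt0// ltr_nat.
    by apply/eqP; rewrite eqn_leq -ltnS lt2 -ltnS.
  have iB : x \in B i by apply/mem_set; rewrite /B /= in_itv.
  rewrite indicE iB mule1; congr ((nat_of_bool _)%:R%:E).
  by apply/idP/idP => [/set_mem|?]; [|apply/mem_set]; rewrite /= in_itv.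
have mhs : measurable_fun setT (h : measurableTypeR R -> \bar R).
  by apply: emeasurable_sum => i; exact: mh.
have hE12 : {in (`]x1, x2]%classic : set R),
    (fun x => cdf_measure (perm_step R s x) `[a, b]%classic) =1 h}.
  move=> x /set_mem /=; rewrite in_itv/= => /andP[xx1 xx2].
  by apply: hE; rewrite (le_lt_trans x10)//= (le_trans xx2).
rewrite -integral_itv_obnd_cbnd; last first.
  apply: (eq_measurable_fun h); last exact: measurable_funTS.
  by move=> x xin; rewrite hE12.
transitivity (\int[mu]_(x in `]x1, x2]) h x)%E.
  by apply: eq_integral => x xin; exact: hE12.
rewrite ge0_integral_sum//; last 2 first.
- by move=> i; exact: measurable_funTS.
- by move=> i x _; rewrite mule_ge0 ?lee_fin.
rewrite big_enum/= /rect_mass -sumEFin; apply: eq_bigr => i _.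
rewrite ge0_integralZl_EFin//; last by apply: measurable_funTS; exact: mh1.
rewrite integral_indic; [|exact: measurable_itv|exact: mB].
rewrite EFinM muleC; congr (_ * _)%E.
rewrite /B /overlap gridptE; set l := _ / _; set d := n%:R^-1.
have d0 : 0 < d by rewrite invr_gt0.
transitivity (mu `]Num.max l x1, Num.min (l + d) x2]%classic).
  congr (mu _); apply/seteqP; split=> x /=; rewrite !in_itv/= gt_max le_min.
    by case=> /andP[-> ->] /andP[-> ->].
  by move=> /andP[/andP[-> ->] /andP[-> ->]].
by rewrite lebesgue_measure_itv/= lte_fin -EFinB overlap_diff//; case: ifP.
Qed.

End Bridge.

Section BridgeError.
Context {R : realType}.
Implicit Types (x y a b e : R).

Lemma sum_overlap n x : (0 < n)%N -> 0 <= x <= 1 -> \sum_(i < n) overlap i x = x.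
Proof.
move=> n0 /andP[x0 x1]; have n0' : 0 < n%:R :> R by rewrite ltr0n.
pose f k : R := Num.min x (k%:R / n%:R).
rewrite -(big_mkord xpredT (fun i => f i.+1 - f i)) telescope_sumr//.
by rewrite /f mul0r divff ?gt_eqF// (min_idPl x1) (min_idPr x0) subr0.
Qed.

Lemma overlap_ge0 n (i : 'I_n) x : 0 <= overlap i x.
Proof.
rewrite /overlap gridptE subr_ge0.
have : 0 <= n%:R^-1 :> R by rewrite invr_ge0.
rewrite /Num.min; move: (_ / _) => l.
by case: (ltP x l); case: (ltP x (l + _)); lra.
Qed.

Lemma overlap_full n (i : 'I_n) x : gridpt i <= x -> overlap i x = n%:R^-1.
Proof.
rewrite /overlap gridptE => ix; rewrite (min_idPr ix) min_r; first by ring.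
by apply: le_trans ix; rewrite lerDl invr_ge0.
Qed.

(** Smearing matters only for the block that contains [x]: the blocks to its left
    overlap fully, those to its right not at all. *)
Lemma overlap_sum_close n (s : 'S_n) x (c : R -> bool) : (0 < n)%N -> 0 <= x <= 1 ->
  `|\sum_(i < n) overlap i x * (c (gridpt (s i)))%:R
    - graph_avg s (fun u v => ((u <= x)%R && c v)%:R)| <= n%:R^-1.
Proof.
move=> n0 x01; have n0' : 0 < n%:R :> R by rewrite ltr0n.
have dE : \sum_(i < n) overlap i x * (c (gridpt (s i)))%:R
    - graph_avg s (fun u v => ((u <= x)%R && c v)%:R) =
    \sum_(i < n) (overlap i x - (gridpt i <= x)%R%:R / n%:R) * (c (gridpt (s i)))%:R.
  rewrite /graph_avg mulr_suml -sumrB; apply: eq_bigr => i _.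
  by rewrite [RHS]mulrBl mulrAC -natrM mulnb.
have t0 (i : 'I_n) : 0 <= overlap i x - (gridpt i <= x)%R%:R / n%:R.
  case: (boolP (gridpt i <= x)) => [ix|_]; first by rewrite overlap_full// mul1r subrr.
  by rewrite mul0r subr0 overlap_ge0.
rewrite dE ger0_norm; last by apply: sumr_ge0 => i _; rewrite mulr_ge0.
apply: (@le_trans _ _ (\sum_(i < n) (overlap i x - (gridpt i <= x)%R%:R / n%:R))).
  by apply: ler_sum => i _; rewrite ler_piMr// lern1 leq_b1.
rewrite sumrB sum_overlap// -mulr_suml.
have /andP[+ _] := grid_cdf_bounds s n0 x01; rewrite /graph_avg; lra.
Qed.

Lemma rect_mass_close n (s : 'S_n) x1 x2 a b : (0 < n)%N ->
  0 <= x1 -> x1 <= x2 -> x2 <= 1 ->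
  `|rect_mass s x1 x2 a b
    - graph_avg s (fun x y => [&& x <= x2, ~~ (x <= x1), y <= b & ~~ (y < a)]%:R)|
  <= 2 * n%:R^-1.
Proof.
move=> n0 x10 x12 x21.
have x101 : 0 <= x1 <= 1 by rewrite x10 (le_trans x12).
have x201 : 0 <= x2 <= 1 by rewrite x21 (le_trans x10).
pose c y := a <= y <= b.
have avgE : graph_avg s (fun x y => [&& x <= x2, ~~ (x <= x1), y <= b & ~~ (y < a)]%:R)
    = graph_avg s (fun u v => ((u <= x2)%R && c v)%:R)
      - graph_avg s (fun u v => ((u <= x1)%R && c v)%:R).
  rewrite -graph_avgB; apply: eq_graph_avg => x y _ _; rewrite /c -leNgt.
  have [xx1|_] := leP x x1; first rewrite (le_trans xx1 x12).
    by rewrite /= subrr.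
  by rewrite /= subr0 [(y <= b) && _]andbC.
rewrite avgE /rect_mass; under eq_bigr do rewrite mulrBl.
rewrite sumrB.
have := overlap_sum_close s c n0 x101; have := overlap_sum_close s c n0 x201.
by rewrite !ler_norml => /andP[? ?] /andP[? ?]; apply/andP; split; lra.
Qed.

Lemma rect_dist_ge m n (s : 'S_m) (p : 'S_n) x1 x2 a b : (0 < m)%N -> (0 < n)%N ->
  0 <= x1 -> x1 < x2 -> x2 <= 1 -> 0 <= a -> a < b -> b <= 1 ->
  (`|rect_mass s x1 x2 a b - rect_mass p x1 x2 a b|%:E <= perm_rect_dist R s p)%E.
Proof.
move=> m0 n0 x10 x12 x21 a0 ab b1; apply: ereal_sup_ubound.
exists x1, x2, a, b; do 2!split => //.
by rewrite !perm_step_integral.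
Qed.

Lemma rect_dist_le m n (s : 'S_m) (p : 'S_n) e : (0 < m)%N -> (0 < n)%N ->
  (forall x1 x2 a b, 0 <= x1 -> x1 < x2 -> x2 <= 1 ->
    `|rect_mass s x1 x2 a b - rect_mass p x1 x2 a b| <= e) ->
  (perm_rect_dist R s p <= e%:E)%E.
Proof.
move=> m0 n0 le_e; apply: ge_ereal_sup => _ [x1 [x2 [a [b [[x10 x12 x21] [_ ->]]]]]].
by rewrite !perm_step_integral// -EFinB abse_EFin lee_fin le_e.
Qed.

Lemma corner_close_rect_dist m n (s : 'S_m) (p : 'S_n) e : (0 < m)%N -> (0 < n)%N ->
  corner_close s p e ->
  (perm_rect_dist R s p <= (4 * e + 2 * m%:R^-1 + 2 * n%:R^-1)%:E)%E.
Proof.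
move=> m0 n0 sp; apply: rect_dist_le => // x1 x2 a b x10 x12 x21.
have := rect_mass_close s a b m0 x10 (ltW x12) x21.
have := rect_mass_close p a b n0 x10 (ltW x12) x21.
have := box_diff sp (@down_closed_le _ x2) (@down_closed_le _ x1)
  (@down_closed_le _ b) (@down_closed_lt _ a).
by rewrite !ler_norml => /andP[? ?] /andP[? ?] /andP[? ?]; apply/andP; split; lra.
Qed.

(** A corner is a box with its lower left vertex at the origin; it is degenerate, hence
    outside the range of the supremum, when [a = 0] or [b = 0]. *)
Lemma rect_dist_corner_close m n (s : 'S_m) (p : 'S_n) e : (0 < m)%N -> (0 < n)%N ->
  0 <= e -> (perm_rect_dist R s p <= e%:E)%E ->
  corner_close s p (e + 2 * m%:R^-1 + 2 * n%:R^-1).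
Proof.
move=> m0 n0 e0 spe a b /andP[a0 a1] /andP[b0 b1].
have m0' : 0 < m%:R^-1 :> R by rewrite invr_gt0 ltr0n.
have n0' : 0 < n%:R^-1 :> R by rewrite invr_gt0 ltr0n.
have [ab|ab] := boolP ((a == 0) || (b == 0)).
  have corner0 k (q : 'S_k) : corner q a b = 0.
    rewrite /corner (_ : graph_avg _ _ = graph_avg q (fun _ _ => 0)).
      by rewrite /graph_avg big1 ?mul0r.
    apply: eq_graph_avg => x y /andP[x0 _] /andP[y0 _].
    by case/orP: ab => /eqP->; rewrite ?(lt_geF x0) ?(lt_geF y0) ?andbF.
  by rewrite !corner0 subrr normr0; lra.
have [a_gt0 b_gt0] : 0 < a /\ 0 < b.
  by move: ab; rewrite negb_or !lt0r a0 b0 !andbT => /andP.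
have cornerE k (q : 'S_k) : corner q a b =
    graph_avg q (fun x y => [&& x <= a, ~~ (x <= 0), y <= b & ~~ (y < 0)]%:R).
  apply: eq_graph_avg => x y /andP[x0 _] /andP[y0 _].
  by rewrite -ltNge x0 -leNgt (ltW y0) andbT.
have := le_trans (rect_dist_ge s p m0 n0 (lexx 0) a_gt0 a1 (lexx 0) b_gt0 b1) spe.
have := rect_mass_close s 0 b m0 (lexx 0) a0 a1.
have := rect_mass_close p 0 b n0 (lexx 0) a0 a1.
rewrite !cornerE lee_fin !ler_norml => /andP[? ?] /andP[? ?] /andP[? ?].
by apply/andP; split; lra.
Qed.

Lemma rect_dist_refl n (s : 'S_n) : (0 < n)%N -> (perm_rect_dist R s s <= 0%:E)%E.
Proof. by move=> n0; apply: rect_dist_le => // *; rewrite subrr normr0. Qed.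

End BridgeError.

(** * Order types of tuples of points *)

Section OrderTypes.
Local Open Scope nat_scope.

Lemma card_ord_lt n v : v <= n -> #|[pred i : 'I_n | i < v]| = v.
Proof.
move=> vn; rewrite -sum1_card.
by rewrite (big_ord_narrow vn (F := fun=> 1)) sum_nat_const card_ord muln1.
Qed.

(** Random points come in no particular order: the order type of k of them is a pair
    of permutations, one for the abscissae and one for the ordinates. *)
Definition embeddings k n (r t : 'S_k) (p : 'S_n) : {set {ffun 'I_k -> 'I_n}} :=
  [set f : {ffun 'I_k -> 'I_n} | [forall i, forall j,
    ((f i < f j) == (r i < r j)) && ((p (f i) < p (f j)) == (t i < t j))]].

Lemma embeddingsP k n (r t : 'S_k) (p : 'S_n) (f : {ffun 'I_k -> 'I_n}) :
  reflect ((forall i j, (f i < f j) = (r i < r j)) /\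
           (forall i j, (p (f i) < p (f j)) = (t i < t j)))
          (f \in embeddings r t p).
Proof.
rewrite inE; apply: (iffP forallP) => [fP|[fr ft] i].
  by split=> i j; have /forallP/(_ j)/andP[/eqP ? /eqP ?] := fP i.
by apply/forallP => j; rewrite fr ft !eqxx.
Qed.

Lemma card_occurrences k n (t : 'S_k) (p : 'S_n) :
  #|occurrences t p| = #|embeddings 1 t p|.
Proof.
pose F (x : k.-tuple 'I_n) := [ffun i => tnth x i].
have F_inj : injective F.
  by move=> x y /ffunP xy; apply: eq_from_tnth => i; have := xy i; rewrite !ffunE.
rewrite -(card_imset _ F_inj); apply: eq_card => f; apply/imsetP/idP.
  move=> [x + ->]; rewrite inE => /andP[xs /forallP xP].
  have mono (i j : 'I_k) : i < j -> tnth x i < tnth x j.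
    move=> ij; have x0 := tnth x i.
    have := sorted_ltn_nth ltn_trans 0 xs.
    move=> /(_ i j); rewrite !inE size_map size_tuple => /(_ (ltn_ord i) (ltn_ord j) ij).
    by rewrite !(nth_map x0) ?size_tuple// -!tnth_nth.
  apply/embeddingsP; split=> i j; rewrite !ffunE.
    rewrite !perm1; apply/idP/idP => [|/mono//].
    by apply: contraTT; rewrite -!leqNgt leq_eqVlt => /predU1P[/val_inj->//|/mono/ltnW].
  by have /forallP/(_ j)/eqP := xP i.
move=> /embeddingsP[fr ft]; exists [tuple f i | i < k].
  rewrite inE; apply/andP; split.
    apply/(sortedP 0) => i; rewrite size_map size_tuple => ik.
    have x0 := f (Ordinal ik).
    rewrite !(nth_map x0) ?size_tuple ?(ltnW ik)//.
    have -> : nth x0 [tuple f i | i < k] i.+1 = f (Ordinal ik).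
      by rewrite -[i.+1]/(val (Ordinal ik)) -tnth_nth tnth_mktuple.
    have -> : nth x0 [tuple f i | i < k] i = f (Ordinal (ltnW ik)).
      by rewrite -[i in nth _ _ i]/(val (Ordinal (ltnW ik))) -tnth_nth tnth_mktuple.
    by rewrite /ltn/= fr !perm1.
  by apply/forallP => i; apply/forallP => j; rewrite !tnth_mktuple ft.
by apply/ffunP => i; rewrite ffunE tnth_mktuple.
Qed.

(** Relabelling the points by [r^-1] sorts their abscissae. *)
Lemma card_embeddings k n (r t : 'S_k) (p : 'S_n) :
  #|embeddings r t p| = #|embeddings 1 (r^-1 * t) p|.
Proof.
pose F (f : {ffun 'I_k -> 'I_n}) := [ffun i => f (r^-1 i)%g].
have F_inj : injective F.
  by move=> f g /ffunP fg; apply/ffunP => i; have := fg (r i); rewrite !ffunE permK.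
rewrite -(card_imset _ F_inj); apply: eq_card => f; apply/imsetP/idP.
  move=> [g /embeddingsP[gr gt] ->]; apply/embeddingsP.
  by split=> i j; rewrite !ffunE ?gr ?gt ?permM ?perm1 ?permKV.
move=> /embeddingsP[fr ft]; exists [ffun i => f (r i)].
  by apply/embeddingsP; split=> i j; rewrite !ffunE ?fr ?ft ?perm1// !permM !permK.
by apply/ffunP => i; rewrite !ffunE permKV.
Qed.

Lemma perm_rank k (r : 'S_k) (i : 'I_k) : #|[pred j | r j < r i]| = r i.
Proof.
rewrite -[RHS](card_ord_lt (ltnW (ltn_ord (r i)))) -(fintype.card_image (@perm_inj _ r)).
apply: eq_card => j; apply/fintype.imageP/idP => [[x + ->]//|ji].
by exists (r^-1 j)%g; rewrite ?inE permKV.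
Qed.

Lemma perm_order_inj k (r r' : 'S_k) :
  (forall i j, (r i < r j) = (r' i < r' j)) -> r = r'.
Proof.
move=> rr'; apply/permP => i; apply: val_inj; rewrite /= -perm_rank -[RHS]perm_rank.
by apply: eq_card => j; rewrite !inE rr'.
Qed.

Lemma perm_of_order k n (g : 'I_k -> 'I_n) : injective g ->
  exists r : 'S_k, forall i j, (g i < g j) = (r i < r j).
Proof.
move=> g_inj; pose S i := [set j | g j < g i]%SET.
have S_lt i : #|S i| < k.
  rewrite -[X in _ < X]card_ord; apply/proper_card/properP.
  by split; [exact: subset_predT|exists i => //; rewrite /S inE ltnn].
have S_mono i j : g i < g j -> #|S i| < #|S j|.
  move=> ij; apply/proper_card/properP; split; last by exists i; rewrite !inE ?ij ?ltnn.
  by apply/fintype.subsetP => l; rewrite !inE => /ltn_trans; apply.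
pose rk i := Ordinal (S_lt i).
have rk_inj : injective rk.
  move=> i j /(congr1 val)/= ij; apply/g_inj/val_inj/eqP.
  by case: ltngtP => // /S_mono; rewrite ij ltnn.
exists (perm rk_inj) => i j; rewrite !permE /=; apply/idP/idP => [/S_mono//|].
apply: contraTT; rewrite -!leqNgt leq_eqVlt => /predU1P[/val_inj/g_inj->//|].
by move=> /S_mono/ltnW.
Qed.

(** An injective tuple of points has exactly one order type, so an event that
    depends only on the order type is a disjoint union of embedding sets. *)
Lemma card_order_event k n (p : 'S_n) (e : pred ('S_k * 'S_k))
    (E : pred {ffun 'I_k -> 'I_n}) :
  (forall r t f, f \in embeddings r t p -> E f = e (r, t)) ->
  #|[set f : {ffun 'I_k -> 'I_n} | injectiveb f && E f]%SET| =
  \sum_(q | e q) #|embeddings q.1 q.2 p|.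
Proof.
move=> Ee; rewrite -sum1dep_card big_mkcond/=.
transitivity (\sum_(q | e q) \sum_(f : {ffun 'I_k -> 'I_n}) (f \in embeddings q.1 q.2 p)).
  rewrite exchange_big/=; apply: eq_bigr => f _.
  case: (boolP (injectiveb f)) => [/injectiveP f_inj|nf_inj] /=; last first.
    rewrite big1// => -[r t] _ /=; apply/eqP; rewrite eqb0; apply: contra nf_inj.
    move=> /embeddingsP[fr _]; apply/injectiveP => i j ij; apply: (@perm_inj _ r).
    apply/val_inj/eqP; case: ltngtP => //; by rewrite -fr ij ltnn.
  have [r rP] := perm_of_order f_inj.
  have [t tP] := perm_of_order (inj_comp (@perm_inj _ p) f_inj).
  have fin : f \in embeddings r t p by apply/embeddingsP.
  have other q : q != (r, t) -> (f \in embeddings q.1 q.2 p) = false.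
    case: q => r' t' /=; apply: contraNF => /embeddingsP[fr' ft'].
    by apply/eqP; congr pair; apply: perm_order_inj => i j; rewrite -?fr' -?ft' ?rP ?tP.
  case: ifP => Ef.
    rewrite (bigD1 (r, t)) -?(Ee _ _ _ fin)//= fin big1 ?addn0// => q /andP[_ /other->//].
  rewrite big1// => q eq; have [qrt|/other->//] := eqVneq q (r, t).
  by move: eq; rewrite qrt -(Ee _ _ _ fin) Ef.
by apply: eq_bigr => q _; rewrite -sum1_card [RHS]big_mkcond; apply: eq_bigr => f _; case: ifP.
Qed.

Lemma card_injective_ffuns k n :
  #|[set f : {ffun 'I_k -> 'I_n} | injectiveb f]%SET| = n ^_ k.
Proof. by rewrite card_inj_ffuns !card_ord. Qed.

Lemma leq_ffact_exp n k : n ^_ k <= n ^ k.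
Proof.
by elim: k => // k IHk; rewrite ffactnSr expnSr leq_mul// leq_subr.
Qed.

Lemma sum_card_occurrences k n (p : 'S_n) :
  \sum_(t : 'S_k) #|occurrences t p| = 'C(n, k).
Proof.
apply/eqP; rewrite -(eqn_pmul2r (fact_gt0 k)) bin_ffact -card_injective_ffuns.
have -> : [set f : {ffun 'I_k -> 'I_n} | injectiveb f]%SET =
    [set f : {ffun 'I_k -> 'I_n} | injectiveb f && xpredT f]%SET.
  by apply/setP => f; rewrite !inE andbT.
rewrite (card_order_event (p := p) (e := xpredT))//.
rewrite -(pair_bigA _ (fun r t => #|embeddings r t p|))/=.
rewrite (eq_bigr (fun=> \sum_(t : 'S_k) #|occurrences t p|)) => [|r _].
  by rewrite sum_nat_const card_Sn mulnC.
rewrite [RHS](reindex_inj (@mulgI _ r^-1%g)); apply: eq_bigr => t _.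
by rewrite card_embeddings card_occurrences.
Qed.

(** The error term counts the tuples with a repetition, whose order type is not a
    pair of permutations. *)
Lemma card_order_event_bounds k n (p : 'S_n) (e : pred ('S_k * 'S_k))
    (E : pred {ffun 'I_k -> 'I_n}) :
  (forall r t f, f \in embeddings r t p -> E f = e (r, t)) ->
  \sum_(q | e q) #|occurrences (q.1^-1 * q.2)%g p| <= #|[set f | E f]%SET| <=
  \sum_(q | e q) #|occurrences (q.1^-1 * q.2)%g p| + (n ^ k - n ^_ k).
Proof.
move=> /card_order_event cardE.
have -> : \sum_(q | e q) #|occurrences (q.1^-1 * q.2)%g p| =
    #|[set f : {ffun 'I_k -> 'I_n} | injectiveb f && E f]%SET|.
  by rewrite cardE; apply: eq_bigr => q _; rewrite [RHS]card_embeddings card_occurrences.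
pose I := [set f : {ffun 'I_k -> 'I_n} | injectiveb f]%SET.
pose B := [set f : {ffun 'I_k -> 'I_n} | E f]%SET.
have -> : [set f : {ffun 'I_k -> 'I_n} | injectiveb f && E f]%SET = B :&: I.
  by apply/setP => f; rewrite !inE andbC.
rewrite -/B subset_leq_card ?subsetIl//= -[leqLHS](cardsID I) leq_add2l.
have -> : n ^ k - n ^_ k = #|~: I|.
  by rewrite -card_injective_ffuns -/I [RHS]cardsCs finset.setCK card_ffun !card_ord.
by apply/subset_leq_card/fintype.subsetP => f; rewrite !inE => /andP[].
Qed.

End OrderTypes.

(** * Pattern densities along a sequence of permutations *)

Section Sequences.
Context {R : realType}.
Implicit Types (u v : nat -> R).

Lemma cvgn_cauchyP u : cvgn u <->
  forall e, 0 < e -> exists n0, forall n m, (n0 <= n)%N -> (n0 <= m)%N ->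
    `|u n - u m| < e.
Proof.
split=> [/cvgrPdist_lt u_cvg e e0|u_cauchy].
  have [|n0 _ n0P] := u_cvg (e / 2); first by rewrite divr_gt0.
  exists n0 => n m n0n n0m; rewrite [e]splitr.
  apply: le_lt_trans (ler_distD (limn u) _ _) _.
  by rewrite ltrD//; [rewrite distrC|]; apply: n0P.
apply/cauchy_cvgP/cauchy_exP => e e0; have [n0 n0P] := u_cauchy e e0.
by exists (u n0); exists n0 => // n /= n0n; rewrite /ball/= n0P.
Qed.

Lemma is_cvg_sumn (I : Type) (r : seq I) (P : pred I) (F : I -> nat -> R) :
  (forall i, P i -> cvgn (F i)) -> cvgn (fun n => \sum_(i <- r | P i) F i n).
Proof.
move=> Fcvg; apply: (@cvgP _ _ (\sum_(i <- r | P i) limn (F i))).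
apply: cvg_big => [|i Pi]; last exact: Fcvg.
exact: add_continuous.
Qed.

Lemma eventually_eq_cvg_to u v (l : R) :
  (\forall n \near \oo, u n = v n) ->
  u n @[n --> \oo] --> l -> v n @[n --> \oo] --> l.
Proof. by move=> uv; apply: cvg_trans; apply: near_eq_cvg. Qed.

Lemma eventually_eq_cvgn u v :
  (\forall n \near \oo, u n = v n) -> cvgn u -> cvgn v.
Proof. by move=> uv cu; apply: (@cvgP _ _ (limn u)); exact: eventually_eq_cvg_to cu. Qed.

Lemma ffact_ratio_cvg k :
  (n ^_ k)%:R / n%:R ^+ k @[n --> \oo] --> (1 : R).
Proof.
have inv_cvg : n%:R^-1 @[n --> \oo] --> (0 : R).
  apply/gtr0_cvgV0; last exact: cvgr_idn.
  by exists 1%N => // n /= n1; rewrite ltr0n.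
elim: k => [|k IHk].
  by under eq_cvg do rewrite ffactn0 expr0 divr1; exact: cvg_cst.
have step : (1 - k%:R * n%:R^-1) @[n --> \oo] --> (1 : R).
  suff : (1 - k%:R * n%:R^-1) @[n --> \oo] --> (1 - k%:R * 0 : R).
    by rewrite mulr0 subr0.
  apply: cvgB; first exact: cvg_cst.
  by apply: cvgM => //; exact: cvg_cst.
apply: (@eventually_eq_cvg_to
  (fun n => (n ^_ k)%:R / n%:R ^+ k * (1 - k%:R * n%:R^-1))); last first.
  by rewrite -[X in _ --> X]mulr1; exact: cvgM.
exists k.+1 => // n /= kn.
have n0 : n%:R != 0 :> R by rewrite pnatr_eq0 -lt0n (leq_trans _ kn).
rewrite ffactnSr natrM natrB ?(ltnW kn)// exprSr invfM.
by rewrite [RHS]mulrACA mulrBl divff.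
Qed.

Lemma cvgn_comp_pinfty (len : nat -> nat) (f : nat -> R) (l : R) :
  len n @[n --> \oo] --> \oo -> f n @[n --> \oo] --> l ->
  f (len n) @[n --> \oo] --> l.
Proof. by move=> len_oo f_l; apply: (cvg_comp _ _ len_oo). Qed.

(** Unlike for the density, the k points are drawn independently, with replacement. *)
Definition pattern_freq k n (t : 'S_k) (p : 'S_n) : R :=
  #|occurrences t p|%:R / n%:R ^+ k.

Lemma pattern_freq_density k n (t : 'S_k) (p : 'S_n) : (k <= n)%N -> (0 < n)%N ->
  pattern_freq t p = perm_density R t p * ((n ^_ k)%:R / n%:R ^+ k / k`!%:R).
Proof.
move=> kn n0; rewrite /pattern_freq /perm_density kn -bin_ffact natrM.
have C0 : 'C(n, k)%:R != 0 :> R by rewrite pnatr_eq0 -lt0n bin_gt0.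
have F0 : k`!%:R != 0 :> R by rewrite pnatr_eq0 -lt0n fact_gt0.
by field; rewrite C0 F0 expf_neq0// pnatr_eq0 -lt0n n0.
Qed.

Section LongPermutations.
Variables (len : nat -> nat) (sigma : forall n, 'S_(len n)).
Hypothesis len_gt0 : forall n, (0 < len n)%N.
Hypothesis len_oo : len n @[n --> \oo] --> \oo.

Lemma cvgn_density_freq k (t : 'S_k) :
  cvgn (fun n => perm_density R t (sigma n)) <->
  cvgn (fun n => pattern_freq t (sigma n)).
Proof.
pose c n : R := (len n ^_ k)%:R / (len n)%:R ^+ k / k`!%:R.
have F0 : k`!%:R != 0 :> R by rewrite pnatr_eq0 -lt0n fact_gt0.
have c_cvg : c n @[n --> \oo] --> (k`!%:R^-1 : R).
  rewrite -[X in _ --> X]mul1r; apply: cvgM; last exact: cvg_cst.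
  exact: (cvgn_comp_pinfty len_oo (@ffact_ratio_cvg k)).
have kn : \forall n \near \oo, (k <= len n)%N by move/cvgnyPge : len_oo; exact.
have c0 n : (k <= len n)%N -> c n != 0.
  move=> ken; rewrite !mulf_neq0 ?invr_neq0// ?expf_neq0// pnatr_eq0 -lt0n//.
  by rewrite ffact_gt0.
split=> cvg_u.
  apply: (@eventually_eq_cvgn (fun n => perm_density R t (sigma n) * c n)).
    by apply: filterS kn => n ken; rewrite pattern_freq_density.
  by apply: is_cvgM => //; exact: cvgP c_cvg.
apply: (@eventually_eq_cvgn (fun n => pattern_freq t (sigma n) / c n)).
  by apply: filterS kn => n ken; rewrite pattern_freq_density// mulfK// c0.
apply: is_cvgM => //; apply: (@cvgP _ _ (k`!%:R : R)); rewrite -[X in _ --> X]invrK.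
by apply: cvgV c_cvg; rewrite invr_neq0.
Qed.

(** Up to repetitions, whose probability tends to 0, the event is a disjoint union of
    patterns, each of them read in a permuted order. *)
Lemma cvgn_order_event k (e : pred ('S_k * 'S_k))
    (E : forall n, pred {ffun 'I_k -> 'I_(len n)}) :
  (forall t : 'S_k, cvgn (fun n => perm_density R t (sigma n))) ->
  (forall n r t f, f \in embeddings r t (sigma n) -> E n f = e (r, t)) ->
  cvgn (fun n => #|[set f | E n f]%SET|%:R / (len n)%:R ^+ k : R).
Proof.
move=> dens_cvg Ee.
pose S n : R := \sum_(q | e q) pattern_freq (q.1^-1 * q.2)%g (sigma n).
have S_cvg : cvgn S.
  apply: is_cvg_sumn => q _.
  exact: (cvgn_density_freq (q.1^-1 * q.2)%g).1 (dens_cvg _).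
pose r n : R := #|[set f | E n f]%SET|%:R / (len n)%:R ^+ k - S n.
suff r_cvg : r n @[n --> \oo] --> (0 : R).
  apply: (@eventually_eq_cvgn (fun n => S n + r n)).
    by near=> n; rewrite /r addrC subrK.
  by apply: is_cvgD => //; exact: cvgP r_cvg.
have bnd_cvg : 1 - (len n ^_ k)%:R / (len n)%:R ^+ k @[n --> \oo] --> (0 : R).
  rewrite -(subrr 1); apply: cvgB; first exact: cvg_cst.
  exact: (cvgn_comp_pinfty len_oo (@ffact_ratio_cvg k)).
apply: (squeeze_cvgr _ (cvg_cst 0) bnd_cvg); near=> n.
have n0 : 0 < (len n)%:R ^+ k :> R by rewrite exprn_gt0// ltr0n.
have ffact_le := leq_ffact_exp (len n) k.
have /andP[lo hi] := card_order_event_bounds (Ee n).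
rewrite /r /S -mulr_suml -mulrBl -natr_sum; apply/andP; split.
  by rewrite divr_ge0 ?(ltW n0)// subr_ge0 ler_nat.
rewrite ler_pdivrMr// mulrBl mul1r divfK ?gt_eqF// lerBlDl.
by rewrite -natrX -natrB// -natrD ler_nat.
Unshelve. all: by end_near. Qed.

End LongPermutations.

End Sequences.

(** * Close distribution functions have close pattern frequencies *)

Section Hybrid.
Context {R : realType}.

Definition update (I : eqType) (T : Type) (c : I -> T) (j : I) (x : T) : I -> T :=
  fun i => if i == j then x else c i.

Definition fupdate (I : finType) (T : Type) (f : {ffun I -> T}) j x : {ffun I -> T} :=
  [ffun i => update f j x i].

(** Redrawing one coordinate of a uniformly random finite function leaves its
    distribution unchanged. *)
Lemma sum_resample (I T : finType) (F : {ffun I -> T} -> R) (j : I) :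
  \sum_(f : {ffun I -> T}) \sum_v F (fupdate f j v) =
  #|T|%:R * \sum_f F f.
Proof.
pose h (q : {ffun I -> T} * T) := (fupdate q.1 j q.2, q.1 j).
have hK : involutive h.
  move=> [f v]; rewrite /h /= ffunE /fupdate /update eqxx; congr pair.
  by apply/ffunP => i; rewrite !ffunE; case: eqP => // ->.
rewrite (pair_bigA _ (fun (f : {ffun I -> T}) v => F (fupdate f j v)))/=.
rewrite (reindex_inj (can_inj hK))/=.
under eq_bigr => q _ do rewrite -[fupdate _ _ _]/(h (h q)).1 hK.
rewrite -(pair_bigA _ (fun (f : {ffun I -> T}) (_ : T) => F f))/= exchange_big sumr_const.
by rewrite mulr_natl.
Qed.

Definition ordered_as k (w : 'I_k -> nat) (u : 'I_k -> R) :=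
  [forall i, forall j, (u i < u j)%R == (w i < w j)%N].

(** Whether a value fits into a prescribed order relative to the others is decided
    by one lower and one upper bound. *)
Lemma ordered_as_update k (w : 'I_k -> nat) (u : 'I_k -> R) j x : injective w ->
  ordered_as w (update u j x) =
  [&& [forall i, forall i', (i != j) && (i' != j) ==>
         ((u i < u i')%R == (w i < w i')%N)],
      [forall i, (w j < w i)%N ==> (x < u i)%R] &
      ~~ [exists i, (w i < w j)%N && (x <= u i)%R]].
Proof.
move=> w_inj; apply/forallP/and3P => [ord|[/forallP others /forallP above below] i].
  have {}ord i i' : (update u j x i < update u j x i') = (w i < w i')%N.
    by have /forallP/(_ i')/eqP := ord i.
  split.
  - apply/forallP => i; apply/forallP => i'; apply/implyP => /andP[ij i'j].
    by have := ord i i'; rewrite /update (negPf ij) (negPf i'j) => ->.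
  - apply/forallP => i; apply/implyP => wji; have := ord j i.
    by rewrite /update eqxx; case: eqVneq wji => [->|_ ->//]; rewrite ltnn.
  - apply/existsPn => i; apply/negP => /andP[wij xui]; have := ord i j.
    by rewrite /update eqxx; case: eqVneq wij => [->|_ ->]; rewrite ?ltnn// ltNge xui.
have {}below l : (w l < w j)%N -> u l < x.
  move=> wlj; rewrite ltNge; apply: contra below => xul.
  by apply/existsP; exists l; rewrite wlj.
have {}above l : (w j < w l)%N -> x < u l by have /implyP := above l.
apply/forallP => i'; rewrite /update.
case: (eqVneq i j) => [->|ij]; case: (eqVneq i' j) => [->|i'j].
- by rewrite ltxx ltnn.
- case: (ltngtP (w j) (w i')) => [/above->//|/below/lt_gtF->//|/w_inj ji'].
  by rewrite ji' eqxx in i'j.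
- case: (ltngtP (w i) (w j)) => [/below->//|/above/lt_gtF->//|/w_inj ji'].
  by rewrite ji' eqxx in ij.
- by have /forallP/(_ i')/implyP := others i; rewrite ij i'j; apply.
Qed.

Definition pattern_test k (t : 'S_k) (c : 'I_k -> R * R) : R :=
  (ordered_as (fun i => i) (fst \o c) && ordered_as (fun i => t i) (snd \o c))%:R.

(** When all points but one are fixed, the last one has to lie in a box. *)
Lemma pattern_test_box k (t : 'S_k) (c : 'I_k -> R * R) j :
  exists d1 e1 d2 e2 : pred R,
    [/\ down_closed d1, down_closed e1, down_closed d2 & down_closed e2] /\
    forall x y, pattern_test t (update c j (x, y)) =
      [&& d1 x, ~~ e1 x, d2 y & ~~ e2 y]%:R.
Proof.
pose rest (w : 'I_k -> nat) (u : 'I_k -> R) := [forall i, forall i',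
  (i != j) && (i' != j) ==> ((u i < u i')%R == (w i < w i')%N)].
pose up (w : 'I_k -> nat) (u : 'I_k -> R) x := [forall i, (w j < w i)%N ==> (x < u i)%R].
pose lo (w : 'I_k -> nat) (u : 'I_k -> R) x := [exists i, (w i < w j)%N && (x <= u i)%R].
have up_down w u : down_closed (up w u).
  move=> x y xy /forallP upy; apply/forallP => i; apply/implyP => wji.
  by apply: le_lt_trans xy _; have /implyP := upy i; apply.
have lo_down w u : down_closed (lo w u).
  move=> x y xy /existsP[i /andP[wij yui]]; apply/existsP; exists i.
  by rewrite wij (le_trans xy).
exists (fun x => rest (fun i => i) (fst \o c) && up (fun i => i) (fst \o c) x),
  (lo (fun i => i) (fst \o c)),
  (fun y => rest (fun i => t i) (snd \o c) && up (fun i => t i) (snd \o c) y),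
  (lo (fun i => t i) (snd \o c)).
split.
  by split=> // x y xy /andP[-> /(up_down _ _ _ _ xy)->].
move=> x y; rewrite /pattern_test; congr (nat_of_bool _)%:R.
have fstE : fst \o update c j (x, y) = update (fst \o c) j x.
  by apply/funext => i; rewrite /update/=; case: eqP.
have sndE : snd \o update c j (x, y) = update (snd \o c) j y.
  by apply/funext => i; rewrite /update/=; case: eqP.
rewrite fstE sndE !ordered_as_update.
- by rewrite -!andbA.
- by move=> a b /val_inj/perm_inj.
- exact: val_inj.
Qed.

Definition graph_pt n (p : 'S_n) (i : 'I_n) : R * R := (gridpt i, gridpt (p i)).

Lemma pattern_freqE k n (t : 'S_k) (p : 'S_n) :
  pattern_freq t p =
  (\sum_(f : {ffun 'I_k -> 'I_n}) pattern_test t (graph_pt p \o f)) / n%:R ^+ k.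
Proof.
rewrite /pattern_freq card_occurrences -sum1_card big_mkcond natr_sum; congr (_ / _).
apply: eq_bigr => f _; rewrite /pattern_test.
have -> : (ordered_as (fun i => i) (fst \o (graph_pt p \o f)) &&
    ordered_as (fun i => t i) (snd \o (graph_pt p \o f))) = (f \in embeddings 1 t p).
  apply/andP/embeddingsP => -[ordx ordy]; split.
  - by move=> i j; have /forallP/(_ i)/forallP/(_ j)/eqP := ordx; rewrite /= ltr_gridpt !perm1.
  - by move=> i j; have /forallP/(_ i)/forallP/(_ j)/eqP := ordy; rewrite /= ltr_gridpt.
  - apply/forallP => i; apply/forallP => j; apply/eqP.
    by rewrite /= ltr_gridpt ordx !perm1.
  - by apply/forallP => i; apply/forallP => j; apply/eqP; rewrite /= ltr_gridpt ordy.
by case: ifP.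
Qed.

Section Swap.
Variables (k m n : nat) (s : 'S_m) (p : 'S_n) (t : 'S_k) (e : R).
Hypotheses (m0 : (0 < m)%N) (n0 : (0 < n)%N) (sp : corner_close s p e).

Let mix l (f : {ffun 'I_k -> 'I_m}) (g : {ffun 'I_k -> 'I_n}) (i : 'I_k) : R * R :=
  if (i < l)%N then graph_pt s (f i) else graph_pt p (g i).

(** Interpolates between the frequency in [p] at [l = 0] and that in [s] at [l = k]. *)
Let hybrid l : R :=
  (\sum_f \sum_g pattern_test t (mix l f g)) / (m%:R ^+ k * n%:R ^+ k).

Let hybrid_step (j : 'I_k) : `|hybrid j.+1 - hybrid j| <= 4 * e.
Proof.
pose B f g z : R := pattern_test t (update (mix j f g) j z).
have m0' : m%:R != 0 :> R by rewrite pnatr_eq0 -lt0n.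
have n0' : n%:R != 0 :> R by rewrite pnatr_eq0 -lt0n.
have sumS : \sum_f \sum_g pattern_test t (mix j.+1 f g) =
    \sum_f \sum_g graph_avg s (fun x y => B f g (x, y)).
  apply: (mulfI m0'); rewrite -{1}[m]card_ord -(sum_resample _ j) mulr_sumr.
  apply: eq_bigr => f _; rewrite exchange_big mulr_sumr; apply: eq_bigr => g _.
  rewrite /graph_avg mulrC divfK//; apply: eq_bigr => v _.
  rewrite /B; congr pattern_test; apply/funext => i.
  rewrite /mix /fupdate /update ffunE ltnS leq_eqVlt.
  by rewrite -val_eqE; case: eqP.
have sumP : \sum_f \sum_g pattern_test t (mix j f g) =
    \sum_f \sum_g graph_avg p (fun x y => B f g (x, y)).
  apply: eq_bigr => f _.
  apply: (mulfI n0'); rewrite -{1}[n]card_ord -(sum_resample _ j) mulr_sumr.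
  apply: eq_bigr => g _; rewrite /graph_avg mulrC divfK//; apply: eq_bigr => v _.
  rewrite /B; congr pattern_test; apply/funext => i; rewrite /mix /fupdate /update ffunE.
  by case: eqP => // ->; rewrite ltnn.
have N0 : 0 < m%:R ^+ k * n%:R ^+ k :> R by rewrite mulr_gt0// exprn_gt0// ltr0n.
rewrite /hybrid sumS sumP -mulrBl normrM normfV (gtr0_norm N0) ler_pdivrMr//.
rewrite -sumrB; apply: le_trans (ler_norm_sum _ _ _) _.
have -> : 4 * e * (m%:R ^+ k * n%:R ^+ k) =
    \sum_(f : {ffun 'I_k -> 'I_m}) \sum_(g : {ffun 'I_k -> 'I_n}) 4 * e.
  rewrite !sumr_const !card_ffun !card_ord -mulrnA -[RHS]mulr_natr natrM !natrX.
  by rewrite [_ ^+ k * _]mulrC.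
apply: ler_sum => f _; rewrite -sumrB; apply: le_trans (ler_norm_sum _ _ _) _.
apply: ler_sum => g _.
have [d1 [e1 [d2 [e2 [[dd1 de1 dd2 de2] BB]]]]] := pattern_test_box t (mix j f g) j.
have avgE k' (q : 'S_k') : graph_avg q (fun x y => B f g (x, y)) =
    graph_avg q (fun x y => [&& d1 x, ~~ e1 x, d2 y & ~~ e2 y]%:R).
  by apply: eq_graph_avg => x y _ _; rewrite -BB.
by rewrite !avgE; exact: box_diff.
Qed.

(** The random points are exchanged one at a time, at a cost of [4 * e] each. *)
Lemma pattern_freq_diff : `|pattern_freq t s - pattern_freq t p| <= k%:R * (4 * e).
Proof.
have m0' : m%:R ^+ k != 0 :> R by rewrite expf_neq0// pnatr_eq0 -lt0n.
have n0' : n%:R ^+ k != 0 :> R by rewrite expf_neq0// pnatr_eq0 -lt0n.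
have -> : pattern_freq t p = hybrid 0.
  have sum0 : \sum_f \sum_g pattern_test t (mix 0 f g) =
      m%:R ^+ k * \sum_(g : {ffun 'I_k -> 'I_n}) pattern_test t (graph_pt p \o g).
    rewrite -natrX -[m in (m ^ k)%N]card_ord -[k in (_ ^ k)%N]card_ord -card_ffun.
    by rewrite mulr_natl -sumr_const.
  by rewrite /hybrid sum0 pattern_freqE -mulf_div divff// mul1r.
have -> : pattern_freq t s = hybrid k.
  have sumk : \sum_f \sum_g pattern_test t (mix k f g) =
      (\sum_(f : {ffun 'I_k -> 'I_m}) pattern_test t (graph_pt s \o f)) * n%:R ^+ k.
    rewrite -natrX -[n in (n ^ k)%N]card_ord -[k in (_ ^ k)%N]card_ord -card_ffun.
    rewrite mulr_natr -sumrMnl; apply: eq_bigr => f _.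
    rewrite -sumr_const; apply: eq_bigr => g _; congr pattern_test.
    by apply/funext => i; rewrite /mix ltn_ord.
  by rewrite /hybrid sumk pattern_freqE -mulf_div divff// mulr1.
rewrite -(telescope_sumr _ (leq0n k)) big_mkord.
apply: le_trans (ler_norm_sum _ _ _) _.
apply: le_trans (ler_sum _ (fun j _ => hybrid_step j)) _.
by rewrite sumr_const card_ord (mulr_natl (4 * e) k).
Qed.

End Swap.

End Hybrid.

(** * Bernstein approximation of step functions *)

Section Bernstein.
Context {R : realType}.
Implicit Types (x a b c d : R) (f g : nat -> R).

(** [(bern N k).[x]] is the probability of [k] successes among [N] independent
    trials of success probability [x]. *)
Fixpoint bern N k : {poly R} :=
  if N is N'.+1 then
    'X * (if k is k'.+1 then bern N' k' else 0) + (1 - 'X) * bern N' k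
  else (k == 0%N)%:R.

Definition bern_exp N f x : R := \sum_(k < N.+1) f k * (bern N k).[x].

Lemma bern_gt N k : (N < k)%N -> bern N k = 0.
Proof.
elim: N k => [|N IHN] [|k]//= Nk.
by rewrite (IHN k Nk) (IHN k.+1 (ltnW Nk)) !mulr0 addr0.
Qed.

Lemma bern_expS N f x :
  bern_exp N.+1 f x = x * bern_exp N (f \o S) x + (1 - x) * bern_exp N f x.
Proof.
rewrite /bern_exp; under eq_bigr do rewrite /= !hornerE mulrDr.
rewrite big_split/=; congr (_ + _).
  rewrite big_ord_recl/= horner0 !mulr0 add0r mulr_sumr.
  by apply: eq_bigr => k _; rewrite mulrCA.
rewrite big_ord_recr/= bern_gt// horner0 !mulr0 addr0 mulr_sumr.
by apply: eq_bigr => k _; rewrite mulrCA.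
Qed.

Lemma bern_exp0 f x : bern_exp 0 f x = f 0%N.
Proof. by rewrite /bern_exp big_ord1 /= hornerC mulr1. Qed.

Lemma bern_ge0 N k x : 0 <= x <= 1 -> 0 <= (bern N k).[x].
Proof.
move=> /andP[x0 x1]; elim: N k => [|N IHN] k; first by rewrite /= -polyC_natr hornerC ler0n.
rewrite /= !hornerE addr_ge0// mulr_ge0 ?subr_ge0//.
by case: k => [|k]; rewrite ?horner0.
Qed.

Lemma le_bern_exp N f g x : 0 <= x <= 1 ->
  (forall k, f k <= g k) -> bern_exp N f x <= bern_exp N g x.
Proof. by move=> x01 fg; apply: ler_sum => k _; rewrite ler_wpM2r ?bern_ge0. Qed.

Lemma bern_expB N f g x :
  bern_exp N (fun k => f k - g k) x = bern_exp N f x - bern_exp N g x.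
Proof. by rewrite -sumrB; apply: eq_bigr => k _; rewrite mulrBl. Qed.

Lemma bern_exp_affine N c d f x :
  bern_exp N (fun k => c + d * f k) x = c * bern_exp N (fun=> 1) x + d * bern_exp N f x.
Proof.
by rewrite !mulr_sumr -big_split; apply: eq_bigr => k _; rewrite mulrDl mul1r mulrA.
Qed.

Lemma bern_exp1 N x : bern_exp N (fun=> 1) x = 1.
Proof.
elim: N => [|N IHN]; first by rewrite bern_exp0.
by rewrite bern_expS [X in x * X]IHN IHN; ring.
Qed.

(** Variance plus squared bias of the number of successes. *)
Lemma bern_exp_sqr N c x :
  bern_exp N (fun k => (k%:R - c) ^+ 2) x = N%:R * x * (1 - x) + (N%:R * x - c) ^+ 2.
Proof.
elim: N c => [|N IHN] c; first by rewrite bern_exp0; ring.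
rewrite bern_expS IHN.
have -> : bern_exp N ((fun k => (k%:R - c) ^+ 2) \o S) x =
    bern_exp N (fun k => (k%:R - (c - 1)) ^+ 2) x.
  by apply: eq_bigr => k _ /=; rewrite -natr1; congr (_ ^+ 2 * _); ring.
by rewrite IHN -natr1; ring.
Qed.

Lemma ler_norm_bern_exp N f x : 0 <= x <= 1 ->
  `|bern_exp N f x| <= bern_exp N (fun k => `|f k|) x.
Proof.
move=> x01; apply: le_trans (ler_norm_sum _ _ _) _; apply: ler_sum => k _.
by rewrite normrM (ger0_norm (bern_ge0 _ _ x01)).
Qed.

Definition bern_step N a x : R := bern_exp N (fun k => (k%:R / N%:R <= a)%R%:R) x.

Lemma bern_step01 N a x : 0 <= x <= 1 -> 0 <= bern_step N a x <= 1.
Proof.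
move=> x01; rewrite -(bern_exp1 N x); apply/andP; split.
  by apply: sumr_ge0 => k _; rewrite mulr_ge0 ?bern_ge0.
by apply: le_bern_exp => // k; rewrite lern1 leq_b1.
Qed.

(** Chebyshev's inequality, except when [x] is within [d] of the jump. *)
Lemma bern_step_close N a x d : (0 < N)%N -> 0 <= x <= 1 -> 0 < d ->
  `|(x <= a)%R%:R - bern_step N a x| <= (a - d < x <= a + d)%R%:R + (N%:R * d ^+ 2)^-1.
Proof.
move=> N0 x01 d0; have N0' : 0 < N%:R :> R by rewrite ltr0n.
have dN0 : 0 < N%:R * d :> R by rewrite mulr_gt0.
have /andP[x0 x1] := x01.
set w : R := (a - d < x <= a + d)%R%:R.
have -> : (x <= a)%R%:R - bern_step N a x =
    bern_exp N (fun k => (x <= a)%R%:R - (k%:R / N%:R <= a)%R%:R) x.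
  rewrite bern_expB; congr (_ - _).
  have -> : bern_exp N (fun=> (x <= a)%R%:R) x =
      bern_exp N (fun k => (x <= a)%R%:R + 0 * 1) x.
    by apply: eq_bigr => k _; rewrite mul0r addr0.
  by rewrite bern_exp_affine bern_exp1 mul0r addr0 mulr1.
apply: le_trans (ler_norm_bern_exp _ _ x01) _.
apply: (@le_trans _ _ (bern_exp N
    (fun k => w + (N%:R * d) ^- 2 * (k%:R - N%:R * x) ^+ 2) x)).
  apply: le_bern_exp => // k.
  have -> : (N%:R * d) ^- 2 * (k%:R - N%:R * x) ^+ 2 = ((k%:R / N%:R - x) / d) ^+ 2.
    by field; rewrite !gt_eqF.
  set y := k%:R / N%:R.
  have far : d <= `|y - x| -> 1 <= ((y - x) / d) ^+ 2.
    move=> dyx; rewrite -[_ ^+ 2]ger0_norm ?sqr_ge0// normrX normrM normfV (gtr0_norm d0).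
    by rewrite exprn_ege1// ler_pdivlMr// mul1r.
  have w0 : 0 <= w by rewrite ler0n.
  have sq0 : 0 <= ((y - x) / d) ^+ 2 by exact: sqr_ge0.
  case: (leP x a) => xa; case: (leP y a) => ya; rewrite ?subrr ?normr0 ?addr_ge0//.
    rewrite subr0 normr1 /w; case: (leP x (a - d)) => xad /=.
      rewrite add0r; apply: far; rewrite ger0_norm; lra.
    by rewrite (_ : x <= a + d) ?lerDl//; lra.
  rewrite sub0r normrN1 /w; case: (leP x (a + d)) => xad; last first.
    rewrite andbF add0r; apply: far; rewrite ler0_norm; lra.
  by rewrite (_ : a - d < x) ?lerDl//; lra.
rewrite bern_exp_affine bern_exp1 mulr1 bern_exp_sqr subrr expr0n/= addr0.
rewrite lerD2l -mulrA.
have -> : (N%:R * d) ^- 2 * (N%:R * (x * (1 - x))) = (N%:R * d ^+ 2)^-1 * (x * (1 - x)).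
  by field; rewrite !gt_eqF.
rewrite ler_piMr//; first by rewrite invr_ge0 mulr_ge0 ?sqr_ge0 ?ler0n.
by rewrite mulr_ile1//; lra.
Qed.

(** Only a proportion about [2 d] of the grid lies within [d] of the jump. *)
Lemma graph_avg_bern_step n (s : 'S_n) N a d : (0 < n)%N -> (0 < N)%N ->
  0 <= a <= 1 -> 0 < d ->
  graph_avg s (fun x _ => `|(x <= a)%R%:R - bern_step N a x|) <=
  2 * d + n%:R^-1 + (N%:R * d ^+ 2)^-1.
Proof.
move=> n0 N0 /andP[a0 a1] d0.
pose hi := Num.min (a + d) 1; pose lo := Num.max (a - d) 0.
have hi01 : 0 <= hi <= 1 by rewrite /hi /Num.min; case: ltP => ?; lra.
have lo01 : 0 <= lo <= 1 by rewrite /lo /Num.max; case: ltP => ?; lra.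
have hilo : hi - lo <= 2 * d.
  by rewrite /hi /lo /Num.min /Num.max; case: ltP => ?; case: ltP => ?; lra.
have lohi : lo <= hi.
  by rewrite /hi /lo /Num.min /Num.max; case: ltP => ?; case: ltP => ?; lra.
apply: (@le_trans _ _ (graph_avg s (fun x _ =>
    ((x <= hi)%R%:R - (x <= lo)%R%:R) + (N%:R * d ^+ 2)^-1))).
  apply: le_graph_avg => x y /andP[x0 x1] _.
  apply: le_trans (bern_step_close _ N0 _ d0) _; first by rewrite ltW.
  rewrite lerD2r /hi /lo le_min le_max x1 andbT (lt_geF x0) orbF.
  case: (leP x (a - d)) => xad /=; last by rewrite subr0.
  by rewrite (_ : x <= a + d) ?subrr//; lra.
rewrite graph_avgD graph_avgB graph_avg_cst//.
have /andP[_ +] := grid_cdf_bounds s n0 hi01.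
have /andP[+ _] := grid_cdf_bounds s n0 lo01.
lra.
Qed.

Lemma corner_bern_close n (s : 'S_n) N a b d : (0 < n)%N -> (0 < N)%N ->
  0 <= a <= 1 -> 0 <= b <= 1 -> 0 < d ->
  `|corner s a b - graph_avg s (fun x y => bern_step N a x * bern_step N b y)| <=
  2 * (2 * d + n%:R^-1 + (N%:R * d ^+ 2)^-1).
Proof.
move=> n0 N0 a01 b01 d0; rewrite /corner -graph_avgB.
apply: le_trans (ler_norm_graph_avg _ _) _.
apply: (@le_trans _ _ (graph_avg s (fun x y =>
    `|(x <= a)%R%:R - bern_step N a x| + `|(y <= b)%R%:R - bern_step N b y|))).
  apply: le_graph_avg => x y /andP[x0 x1] /andP[y0 y1].
  have /andP[p0 p1] : 0 <= bern_step N a x <= 1 by rewrite bern_step01// ltW.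
  rewrite -mulnb natrM; set q := bern_step N b y; set p := bern_step N a x.
  set u := (x <= a)%R%:R; set v := (y <= b)%R%:R.
  have -> : u * v - p * q = (u - p) * v + p * (v - q) by ring.
  apply: le_trans (ler_normD _ _) _; rewrite !normrM lerD//.
    by rewrite ler_piMr// ger0_norm /v ?ler0n// lern1 leq_b1.
  by rewrite ler_piMl// ger0_norm.
rewrite graph_avgD (graph_avg_snd s (fun y => `|(y <= b)%R%:R - bern_step N b y|)).
by rewrite [2 * _]mulr_natl mulr2n lerD// graph_avg_bern_step.
Qed.

(** Finitely many moments control all corners at once, because the coefficients of
    the approximating polynomials in the basis [bern N] are 0 or 1. *)
Lemma corner_close_bern m n (s : 'S_m) (p : 'S_n) N d (eta : R) :
  (0 < m)%N -> (0 < n)%N -> (0 < N)%N -> 0 < d ->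
  (forall k l, (k <= N)%N -> (l <= N)%N ->
    `|graph_avg s (fun x y => (bern N k).[x] * (bern N l).[y])
      - graph_avg p (fun x y => (bern N k).[x] * (bern N l).[y])| <= eta) ->
  corner_close s p (8 * d + 4 * (N%:R * d ^+ 2)^-1 + 2 * m%:R^-1 + 2 * n%:R^-1
    + (N.+1)%:R ^+ 2 * eta).
Proof.
move=> m0 n0 N0 d0 momP a b a01 b01.
have := corner_bern_close s m0 N0 a01 b01 d0.
have := corner_bern_close p n0 N0 a01 b01 d0.
have expE r (q : 'S_r) : graph_avg q (fun x y => bern_step N a x * bern_step N b y) =
    \sum_(k < N.+1) \sum_(l < N.+1) ((k%:R / N%:R <= a)%R && (l%:R / N%:R <= b)%R)%:R *
      graph_avg q (fun x y => (bern N k).[x] * (bern N l).[y]).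
  transitivity (graph_avg q (fun x y => \sum_(k < N.+1) \sum_(l < N.+1)
      ((k%:R / N%:R <= a)%R && (l%:R / N%:R <= b)%R)%:R *
      ((bern N k).[x] * (bern N l).[y]))).
    apply: eq_graph_avg => x y _ _; rewrite /bern_step /bern_exp mulr_suml.
    apply: eq_bigr => k _; rewrite mulr_sumr; apply: eq_bigr => l _.
    by rewrite -mulnb natrM mulrACA.
  rewrite graph_avg_sum; apply: eq_bigr => k _.
  by rewrite graph_avg_sum; apply: eq_bigr => l _; rewrite graph_avgZ.
have : `|graph_avg s (fun x y => bern_step N a x * bern_step N b y)
    - graph_avg p (fun x y => bern_step N a x * bern_step N b y)| <= N.+1%:R ^+ 2 * eta.
  rewrite !expE -sumrB; apply: le_trans (ler_norm_sum _ _ _) _.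
  have -> : N.+1%:R ^+ 2 * eta = \sum_(k < N.+1) \sum_(l < N.+1) eta.
    by rewrite !sumr_const !card_ord -mulrnA -[RHS]mulr_natl natrM expr2.
  apply: ler_sum => k _; rewrite -sumrB; apply: le_trans (ler_norm_sum _ _ _) _.
  apply: ler_sum => l _; rewrite -mulrBr normrM.
  apply: le_trans (momP k l _ _); [|exact: leq_ord..].
  by rewrite ler_piMl// ger0_norm ?ler0n// lern1 leq_b1.
rewrite !ler_norml => /andP[? ?] /andP[? ?] /andP[? ?].
by apply/andP; split; lra.
Qed.

End Bernstein.

(** * Mixed moments are order-type probabilities *)

Section Moments.
Context {R : realType}.

Section Count.
Local Open Scope nat_scope.
Variables (a b n : nat) (p : 'S_n).

(** Given the first point, these [a + b] conditions are independent, and each has the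
   rescaled abscissa or ordinate of that point as its probability. *)
Definition dominates (f : {ffun 'I_(a + b).+1 -> 'I_n}) :=
  [forall i : 'I_a, f (lift ord0 (lshift b i)) <= f ord0]%N &&
  [forall i : 'I_b, p (f (lift ord0 (rshift a i))) <= p (f ord0)]%N.

Lemma card_dominates :
  #|[set f | dominates f]%SET| = (\sum_(i < n) i.+1 ^ a * (p i).+1 ^ b)%N.
Proof.
pose F (i : 'I_n) (j : 'I_(a + b).+1) (v : 'I_n) : bool :=
  if unlift ord0 j is Some j' then
    if fintype.split j' is inl _ then (v <= i)%N else (p v <= p i)%N
  else v == i.
have prodF (f : {ffun 'I_(a + b).+1 -> 'I_n}) i :
    \prod_j F i j (f j) = (f ord0 == i) && dominates f :> nat.
  have -> : \prod_j F i j (f j) = [forall j, F i j (f j)] :> nat.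
    case: (boolP [forall j, F i j (f j)]) => [/forallP Fall|/forallPn[j nF]].
      by rewrite big1// => j _; rewrite Fall.
    by rewrite (bigD1 j)//= (negPf nF) mul0n.
  congr nat_of_bool; apply/forallP/andP => [Fall|[/eqP <- /andP[/forallP dx /forallP dy]] j].
    have f0 : f ord0 = i by have := Fall ord0; rewrite /F unlift_none => /eqP.
    rewrite f0 eqxx; split=> //; apply/andP; rewrite f0.
    split; apply/forallP => j.
      have := Fall (lift ord0 (lshift b j)); rewrite /F liftK.
      by rewrite (unsplitK (inl j : 'I_a + 'I_b)).
    have := Fall (lift ord0 (rshift a j)); rewrite /F liftK.
    by rewrite (unsplitK (inr j : 'I_a + 'I_b)).
  rewrite /F; case: unliftP => [j' ->|->//].
  by have := splitK j'; case: (fintype.split j') => j'' <- /=; [exact: dx|exact: dy].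
rewrite -sum1dep_card big_mkcond/=.
transitivity (\sum_(f : {ffun 'I_(a + b).+1 -> 'I_n}) \sum_(i < n) \prod_j F i j (f j))%N.
  apply: eq_bigr => f _; under eq_bigr do rewrite prodF.
  rewrite (bigD1 (f ord0))//= eqxx big1 => [|i /negPf]; first by rewrite addn0; case: dominates.
  by rewrite eq_sym => ->.
rewrite exchange_big/=; apply: eq_bigr => i _.
rewrite -(bigA_distr_bigA (fun j v => F i j v : nat))/= big_ord_recl big_split_ord/=.
have -> : (\sum_v F i ord0 v = 1)%N.
  rewrite (bigD1 i)//= big1 => [|v /negPf vi]; first by rewrite /F unlift_none eqxx.
  by rewrite /F unlift_none vi.
have card_le (j : 'I_n) : (\sum_(v < n) (v <= j) = j.+1)%N.
  rewrite -[RHS](card_ord_lt (ltn_ord j)) -sum1_card [RHS]big_mkcond.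
  by apply: eq_bigr => v _; rewrite inE ltnS; case: leq.
rewrite mul1n; congr (_ * _)%N.
  rewrite -[X in (_ ^ X)%N](card_ord a) -prod_nat_const; apply: eq_bigr => j _.
  rewrite -card_le; apply: eq_bigr => v _.
  by rewrite /F liftK (unsplitK (inl j : 'I_a + 'I_b)).
rewrite -[X in (_ ^ X)%N](card_ord b) -prod_nat_const; apply: eq_bigr => j _.
rewrite -card_le [RHS](reindex_inj (@perm_inj _ p)); apply: eq_bigr => v _.
by rewrite /F liftK (unsplitK (inr j : 'I_a + 'I_b)).
Qed.

Local Open Scope ring_scope.

Lemma graph_avg_moment : (0 < n)%N ->
  graph_avg p (fun x y : R => x ^+ a * y ^+ b) =
  #|[set f | dominates f]%SET|%:R / n%:R ^+ (a + b).+1.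
Proof.
move=> n0; have n0' : n%:R != 0 :> R by rewrite pnatr_eq0 -lt0n.
rewrite card_dominates natr_sum /graph_avg !mulr_suml; apply: eq_bigr => i _.
rewrite /gridpt !expr_div_n natrM !natrX exprS exprD.
by field; rewrite n0' !expf_neq0.
Qed.

End Count.

Section LongPermutations.
Variables (len : nat -> nat) (sigma : forall n, 'S_(len n)).
Hypothesis len_gt0 : forall n, (0 < len n)%N.
Hypothesis len_oo : len n @[n --> \oo] --> \oo.

Lemma cvgn_moment a b : converges R sigma ->
  cvgn (fun n => graph_avg (sigma n) (fun x y : R => x ^+ a * y ^+ b)).
Proof.
move=> sigma_cvg.
pose e (q : 'S_(a + b).+1 * 'S_(a + b).+1) :=
  [forall i : 'I_a, q.1 (lift ord0 (lshift b i)) <= q.1 ord0]%N &&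
  [forall i : 'I_b, q.2 (lift ord0 (rshift a i)) <= q.2 ord0]%N.
under eq_fun do rewrite graph_avg_moment//.
apply: (cvgn_order_event len_gt0 len_oo (e := e)) => [t|n r t f /embeddingsP[fr ft]].
  exact: sigma_cvg.
rewrite /dominates /e /=; congr (_ && _); apply: eq_forallb => i.
  by rewrite leqNgt fr -leqNgt.
by rewrite leqNgt ft -leqNgt.
Qed.

Lemma cvgn_poly_avg (P Q : {poly R}) : converges R sigma ->
  cvgn (fun n => graph_avg (sigma n) (fun x y : R => P.[x] * Q.[y])).
Proof.
move=> sigma_cvg.
have avgE n : graph_avg (sigma n) (fun x y : R => P.[x] * Q.[y]) =
    \sum_(i < size P) \sum_(j < size Q)
      P`_i * Q`_j * graph_avg (sigma n) (fun x y => x ^+ i * y ^+ j).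
  transitivity (graph_avg (sigma n) (fun x y : R =>
      \sum_(i < size P) \sum_(j < size Q) P`_i * Q`_j * (x ^+ i * y ^+ j))).
    apply: eq_graph_avg => x y _ _; rewrite !horner_coef mulr_suml.
    by apply: eq_bigr => i _; rewrite mulr_sumr; apply: eq_bigr => j _; rewrite mulrACA.
  rewrite graph_avg_sum; apply: eq_bigr => i _.
  by rewrite graph_avg_sum; apply: eq_bigr => j _; rewrite graph_avgZ.
under eq_fun do rewrite avgE.
apply: is_cvg_sumn => i _; apply: is_cvg_sumn => j _.
apply: is_cvgM; last exact: cvgn_moment.
exact: is_cvg_cst.
Qed.

End LongPermutations.

End Moments.

(** * Sequences of permutations whose lengths tend to infinity *)

Section LongCase.
Context {R : realType}.
Variables (len : nat -> nat) (sigma : forall n, 'S_(len n)).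
Hypothesis len_gt0 : forall n, (0 < len n)%N.
Hypothesis len_oo : len n @[n --> \oo] --> \oo.

Definition corner_cauchy := forall e : R, 0 < e -> exists n0, forall n m,
  (n0 <= n)%N -> (n0 <= m)%N -> corner_close (sigma n) (sigma m) e.

Lemma len_inv_small (e : R) : 0 < e ->
  exists n0, forall n, (n0 <= n)%N -> (len n)%:R^-1 < e.
Proof.
move=> e0; have [n0 _ n0P] : \forall n \near \oo, ((Num.truncn e^-1).+1 <= len n)%N.
  by move/cvgnyPge : len_oo; exact.
exists n0 => n /n0P /= len_big; rewrite invf_plt ?posrE ?ltr0n//.
by apply: lt_le_trans (truncnS_gt _) _; rewrite ler_nat.
Qed.

(** The two notions differ by a factor 4 and by terms of order [1 / len n]. *)
Lemma rect_cauchy_corner_cauchy : rect_cauchy R sigma <-> corner_cauchy.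
Proof.
split=> cauchy_s e e0.
  have [n1 n1P] := cauchy_s (e / 2) (divr_gt0 e0 (ltr0Sn _ _)).
  have [n2 n2P] := len_inv_small (divr_gt0 e0 (ltr0Sn _ 7)).
  exists (maxn n1 n2) => n m; rewrite !geq_max => /andP[n1n n2n] /andP[n1m n2m] a b a01 b01.
  have e20 : 0 <= e / 2 by rewrite divr_ge0 ?ltW.
  have := rect_dist_corner_close (len_gt0 n) (len_gt0 m) e20 (ltW (n1P n m n1n n1m)) a01 b01.
  by move=> /le_trans; apply; have := n2P _ n2n; have := n2P _ n2m; lra.
have [n1 n1P] := cauchy_s (e / 16) (divr_gt0 e0 (ltr0Sn _ _)).
have [n2 n2P] := len_inv_small (divr_gt0 e0 (ltr0Sn _ 7)).
exists (maxn n1 n2) => n m; rewrite !geq_max => /andP[n1n n2n] /andP[n1m n2m].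
apply: le_lt_trans (corner_close_rect_dist (len_gt0 n) (len_gt0 m) (n1P n m n1n n1m)) _.
by rewrite lte_fin; have := n2P _ n2n; have := n2P _ n2m; lra.
Qed.

Lemma corner_cauchy_converges : corner_cauchy -> converges R sigma.
Proof.
move=> cauchy_s k t k0; apply/(cvgn_density_freq sigma len_gt0 len_oo)/cvgn_cauchyP => e e0.
have k0' : 0 < k%:R :> R by rewrite ltr0n.
have [|n0 n0P] := cauchy_s (e / (8 * k%:R)); first by rewrite divr_gt0// mulr_gt0.
exists n0 => n m n0n n0m.
apply: le_lt_trans (pattern_freq_diff t (len_gt0 n) (len_gt0 m) (n0P n m n0n n0m)) _.
have -> : k%:R * (4 * (e / (8 * k%:R))) = e / 2 by field; rewrite gt_eqF.
lra.
Qed.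

(** Convergent moments make the bound of [corner_close_bern] small. *)
Lemma converges_corner_cauchy : converges R sigma -> corner_cauchy.
Proof.
move=> sigma_cvg e e0.
(* With these choices each of the four groups of terms of that bound is at most
   [e / 4]: [8 * d], the Chebyshev term, the grid terms and the moments. *)
pose d := e / 32; have d0 : 0 < d by rewrite divr_gt0.
pose N := (Num.truncn (16 / (e * d ^+ 2))).+1.
have N_gt0 : (0 < N)%N by [].
have N0 : 0 < N%:R :> R by rewrite ltr0n.
have Nd : 4 * (N%:R * d ^+ 2)^-1 <= e / 4.
  have ed0 : 0 < e * d ^+ 2 by rewrite mulr_gt0// exprn_gt0.
  have := ltW (truncnS_gt (16 / (e * d ^+ 2))); rewrite -/N ler_pdivrMr// => Nbig.
  have Nd0 : 0 < N%:R * d ^+ 2 by rewrite mulr_gt0// exprn_gt0.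
  by rewrite ler_pdivrMr//; lra.
pose eta := e / (4 * N.+1%:R ^+ 2); pose u (q : 'I_N.+1 * 'I_N.+1) n :=
  graph_avg (sigma n) (fun x y : R => (bern N q.1).[x] * (bern N q.2).[y]).
have N20 : 0 < N.+1%:R ^+ 2 :> R by rewrite exprn_gt0// ltr0n.
have eta0 : 0 < eta / 2 by rewrite !divr_gt0// mulr_gt0.
have [n1 _ n1P] : \forall n \near \oo, forall q, `|limn (u q) - u q n| < eta / 2.
  apply: filter_forall => q.
  have /cvgrPdist_lt := cvgn_poly_avg len_gt0 len_oo
    (P := bern N q.1) (Q := bern N q.2) sigma_cvg.
  by apply.
have [n2 n2P] := len_inv_small (divr_gt0 e0 (ltr0Sn _ 15)).
exists (maxn n1 n2) => n m; rewrite !geq_max => /andP[n1n n2n] /andP[n1m n2m] a b a01 b01.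
have mom k l : (k <= N)%N -> (l <= N)%N ->
    `|graph_avg (sigma n) (fun x y : R => (bern N k).[x] * (bern N l).[y])
      - graph_avg (sigma m) (fun x y => (bern N k).[x] * (bern N l).[y])| <= eta.
  move=> kN lN; pose q := (Ordinal (kN : (k < N.+1)%N), Ordinal (lN : (l < N.+1)%N)).
  have := n1P n n1n q; have := n1P m n1m q.
  rewrite distrC; rewrite -/(u q n) -/(u q m) => um un.
  rewrite -(subrK (limn (u q)) (u q n)) -addrA ltW//; apply: le_lt_trans (ler_normD _ _) _.
  by rewrite [eta]splitr ltrD// distrC.
have := corner_close_bern (len_gt0 n) (len_gt0 m) N_gt0 d0 mom a01 b01.
move=> /le_trans; apply.
have -> : N.+1%:R ^+ 2 * eta = e / 4 by rewrite /eta; field; rewrite gt_eqF// ltr0n.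
have dE : 8 * d = e / 4 by rewrite /d; field.
by have := n2P _ n2n; have := n2P _ n2m; lra.
Qed.

End LongCase.

(** * Sequences that repeat a permutation infinitely often *)

Section Rigidity.
Context {R : realType}.

(** Permutations of all sizes in one type, so that permutations whose sizes are not
    known to agree can be compared. *)
Definition tag_perm n (s : 'S_n) : {n & 'S_n} := Tagged (fun n => 'S_n) s.

Lemma overlap_empty n (i : 'I_n) (x : R) : x <= i%:R / n%:R -> overlap i x = 0.
Proof.
move=> xi; rewrite /overlap gridptE (min_idPl xi) min_l ?subrr//.
by rewrite (le_trans xi)// lerDl invr_ge0.
Qed.

(** The top row carries mass exactly [1 / n], which reveals the length. *)
Lemma rect_mass_top n (s : 'S_n) (a : R) : (0 < n)%N -> 1 - n%:R^-1 < a <= 1 ->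
  rect_mass s 0 1 a 1 = n%:R^-1.
Proof.
move=> n0 /andP[a1 a2]; have n0' : 0 < n%:R :> R by rewrite ltr0n.
have -> : rect_mass s 0 1 a 1 = graph_avg s (fun x _ => (a <= x)%R%:R).
  rewrite -(graph_avg_snd s (fun x => (a <= x)%R%:R)) /graph_avg mulr_suml.
  apply: eq_bigr => i _; rewrite overlap_full ?gridpt_le1// overlap_empty ?divr_ge0//.
  by rewrite subr0 mulrC andbT.
have n1n : (n.-1 < n)%N by rewrite prednK.
rewrite /graph_avg (bigD1 (Ordinal n1n))//= big1 => [|i ni].
  by rewrite addr0 /gridpt/= prednK// divff ?gt_eqF// a2 mul1r.
rewrite lt_geF//; apply: le_lt_trans a1; rewrite lerBrDr /gridpt.
rewrite -[X in _ + X]mul1r -mulrDl ler_pdivrMr// mul1r natr1 ler_nat ltn_neqAle ltn_ord andbT.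
by apply: contra ni => /eqP i1n; apply/eqP/val_inj; exact: (congr1 predn i1n).
Qed.

Lemma overlap_block n (i k : 'I_n) :
  overlap k (gridpt i) - overlap k (i%:R / n%:R) = (k == i)%:R * n%:R^-1 :> R.
Proof.
have n0 : 0 < n%:R :> R by rewrite ltr0n (leq_trans _ (ltn_ord i)).
have le_div u v : (u <= v)%N -> u%:R / n%:R <= v%:R / n%:R :> R.
  by move=> uv; rewrite ler_pM2r ?invr_gt0// ler_nat.
have [->|ki] := eqVneq k i.
  by rewrite overlap_full// overlap_empty// subr0 mul1r.
rewrite mul0r; have [lt_ki|lt_ik|/val_inj eq_ki] := ltngtP k i.
- have k_left : gridpt k <= i%:R / n%:R :> R by exact: le_div.
  by rewrite !overlap_full ?subrr// ler_gridpt ltnW.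
- have k_right : gridpt i <= k%:R / n%:R :> R by exact: le_div.
  by rewrite !overlap_empty ?subrr// le_div// ltnW.
- by rewrite eq_ki eqxx in ki.
Qed.

(** A permutation is isolated: a narrow box around an atom separates permutations of
    the same length, and the top row separates the lengths. *)
Lemma rect_dist_rigid m n (s : 'S_m) (p : 'S_n) : (0 < m)%N -> (0 < n)%N ->
  (perm_rect_dist R s p < (m%:R^-1 - m.+1%:R^-1)%:E)%E -> tag_perm p = tag_perm s.
Proof.
move=> m0 n0 sp_lt.
have m0' : 0 < m%:R :> R by rewrite ltr0n.
have n0' : 0 < n%:R :> R by rewrite ltr0n.
have far (x1 x2 a b : R) : 0 <= x1 -> x1 < x2 -> x2 <= 1 -> 0 <= a -> a < b -> b <= 1 ->
    `|rect_mass s x1 x2 a b - rect_mass p x1 x2 a b| < m%:R^-1 - m.+1%:R^-1.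
  move=> x10 x12 x21 a0 ab b1.
  have := le_lt_trans (rect_dist_ge s p m0 n0 x10 x12 x21 a0 ab b1) sp_lt.
  by rewrite lte_fin.
have lt_inv (u v : nat) : (0 < u)%N -> (u < v)%N -> v%:R^-1 < u%:R^-1 :> R.
  by move=> u0 uv; rewrite ltf_pV2 ?posrE ?ltr0n ?ltr_nat// (ltn_trans u0).
have le_inv (u v : nat) : (0 < u)%N -> (u <= v)%N -> v%:R^-1 <= u%:R^-1 :> R.
  by move=> u0 uv; rewrite lef_pV2 ?posrE ?ltr0n ?ler_nat// (leq_trans u0).
have mn : m = n.
  pose a : R := 1 - (m + n)%:R^-1.
  have am : 1 - m%:R^-1 < a by rewrite ltrD2l ltrN2 lt_inv// -[ltnLHS]addn0 ltn_add2l.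
  have an : 1 - n%:R^-1 < a by rewrite ltrD2l ltrN2 lt_inv// -[ltnLHS]add0n ltn_add2r.
  have mn_gt0 : 0 < (m + n)%:R^-1 :> R by rewrite invr_gt0 ltr0n addn_gt0 m0.
  have mn_le1 : (m + n)%:R^-1 <= 1 :> R by rewrite invf_le1 ?ltr0n ?ler1n addn_gt0 m0.
  have a_ge0 : 0 <= a by rewrite /a; lra.
  have a_lt1 : a < 1 by rewrite /a; lra.
  have top_s : rect_mass s 0 1 a 1 = m%:R^-1 by rewrite rect_mass_top// am ltW.
  have top_p : rect_mass p 0 1 a 1 = n%:R^-1 by rewrite rect_mass_top// an ltW.
  have := far 0 1 a 1 (lexx _) ltr01 (lexx _) a_ge0 a_lt1 (lexx _).
  rewrite top_s top_p ltr_norml => /andP[lo hi].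
  apply/eqP; case: ltngtP => // mn.
    by move: hi; rewrite ltrD2l ltrN2 ltNge le_inv.
  (* 1/n - 1/m >= 1/(m-1) - 1/m > 1/m - 1/(m+1) by convexity of the inverse *)
  exfalso; have : n.+1%:R <= m%:R :> R by rewrite ler_nat.
  have : n%:R^-1 < m%:R^-1 + (m%:R^-1 - m.+1%:R^-1) :> R.
    by move: lo; move: (m.+1%:R^-1) (m%:R^-1) (n%:R^-1) => x y z; lra.
  rewrite -!natr1 ltNge => /negP nm H; apply: nm.
  have -> : m%:R^-1 + (m%:R^-1 - (m%:R + 1)^-1) = (m%:R + 2) / (m%:R * (m%:R + 1)) :> R.
    by field; rewrite !gt_eqF//; lra.
  rewrite ler_pdivrMr; last by rewrite mulr_gt0//; lra.
  by rewrite mulrC ler_pdivlMr//; nra.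
subst n; congr (Tagged _ _); apply/permP => i; apply/eqP/negPn/negP => pi_si.
pose b : R := gridpt (s i); pose a := b - (2 * m%:R)^-1.
have inv_m : m%:R^-1 = (2 * m%:R)^-1 + (2 * m%:R)^-1 :> R.
  by field; rewrite gt_eqF.
have half_gt0 : 0 < (2 * m%:R)^-1 :> R by rewrite invr_gt0 mulr_gt0.
have b_ge : m%:R^-1 <= b by rewrite /b gridptE lerDr divr_ge0.
have massE (q : 'S_m) : rect_mass q (i%:R / m%:R) (gridpt i) a b =
    (a <= gridpt (q i) <= b)%R%:R * m%:R^-1.
  rewrite /rect_mass (bigD1 i)//= big1 => [|k /negPf ki].
    by rewrite addr0 overlap_block eqxx mul1r mulrC.
  by rewrite overlap_block ki !mul0r.
have := far (i%:R / m%:R) (gridpt i) a b; rewrite !massE.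
have -> : (a <= gridpt (s i) <= b) by rewrite lexx andbT /a -/b; lra.
have -> : (a <= gridpt (p i) <= b) = false.
  apply/negP => /andP[ap pb]; move: pb; rewrite ler_gridpt leq_eqVlt => /orP[|].
    by rewrite val_eqE (negPf pi_si).
  move=> psi; have : gridpt (p i) <= b - m%:R^-1.
    by rewrite /b (gridptE (s i)) addrK ler_pM2r ?invr_gt0// ler_nat.
  by rewrite /a in ap; lra.
rewrite mul1r mul0r subr0 gtr0_norm ?invr_gt0//.
have i0 : 0 <= i%:R / m%:R :> R by rewrite divr_ge0.
have i1 : i%:R / m%:R < gridpt i :> R by rewrite gridptE ltrDl invr_gt0.
have a0 : 0 <= a by rewrite /a; lra.
have ab : a < b by rewrite /a; lra.
move=> /(_ i0 i1 (gridpt_le1 _) a0 ab (gridpt_le1 _)).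
by rewrite ltNge gerBl invr_ge0 ler0n.
Qed.

Lemma sum_perm_density k n (p : 'S_n) :
  \sum_(t : 'S_k) perm_density R t p = (k <= n)%N%:R.
Proof.
rewrite /perm_density; case: leqP => kn; last by rewrite big1.
by rewrite -mulr_suml -natr_sum sum_card_occurrences divff// pnatr_eq0 -lt0n bin_gt0.
Qed.

Lemma perm_density_ge0 k n (t : 'S_k) (p : 'S_n) : 0 <= perm_density R t p.
Proof. by rewrite /perm_density; case: ifP => // _; rewrite divr_ge0 ?ler0n. Qed.

Lemma perm_density_gt0_eq n (t p : 'S_n) : 0 < perm_density R t p -> t = p.
Proof.
rewrite /perm_density leqnn binn divr1 ltr0n card_occurrences => /card_gt0P[f].
move=> /embeddingsP[f1 ft].
have f_inj : injective f.
  move=> i j fij; apply/val_inj/eqP; case: ltngtP => // ij.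
    by have := f1 i j; rewrite fij ltnn !perm1 ij.
  by have := f1 j i; rewrite fij ltnn !perm1 ij.
have f_id : perm f_inj = 1%g by apply: perm_order_inj => i j; rewrite !permE f1 !perm1.
apply: perm_order_inj => i j; rewrite -ft.
by rewrite -[f i](permE f_inj) -[f j](permE f_inj) f_id !perm1.
Qed.

Lemma perm_density_self n (p : 'S_n) : perm_density R p p = 1.
Proof.
have := sum_perm_density n p; rewrite leqnn (bigD1 p)//= big1 ?addr0// => t tp.
apply/eqP; rewrite eq_le perm_density_ge0 andbT leNgt; apply/negP.
by move=> /perm_density_gt0_eq tpE; rewrite tpE eqxx in tp.
Qed.

Section Recurrence.
Variables (len : nat -> nat) (sigma : forall n, 'S_(len n)).
Hypothesis len_gt0 : forall n, (0 < len n)%N.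

Lemma len_infty_or_recurrent :
  len n @[n --> \oo] --> \oo \/
  exists k (t : 'S_k), forall n0, exists2 n, (n0 <= n)%N & tag_perm (sigma n) = tag_perm t.
Proof.
have [[k [t kt]]|no_rec] := pselect (exists k (t : 'S_k), forall n0,
  exists2 n, (n0 <= n)%N & tag_perm (sigma n) = tag_perm t); first by right; exists k, t.
left; apply/cvgnyPge; elim=> [|A IHA]; first by near=> n.
have neqA : \forall n \near \oo, forall t : 'S_A, tag_perm (sigma n) <> tag_perm t.
  apply: filter_forall => t; apply: contrapT => inf_t; apply: no_rec.
  exists A, t => n0; apply: contrapT => fin_t; apply: inf_t.
  by exists n0 => // n /= n0n nt; apply: fin_t; exists n.
near=> n; rewrite ltn_neqAle; apply/andP; split; last by near: n.
apply/eqP => lenA.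
have : forall t : 'S_A, tag_perm (sigma n) <> tag_perm t by near: n.
by move: (sigma n); rewrite -lenA => s /(_ s).
Unshelve. all: by end_near. Qed.

Section Recurrent.
Variables (k : nat) (t : 'S_k).
Hypothesis recurrent :
  forall n0, exists2 n, (n0 <= n)%N & tag_perm (sigma n) = tag_perm t.

Let k_gt0 : (0 < k)%N.
Proof. by have [n _ /(congr1 (@tag _ _))/= <-] := recurrent 0. Qed.

Let eventually_t := exists n0, forall n, (n0 <= n)%N -> tag_perm (sigma n) = tag_perm t.

(** Far out in the sequence, the density of [t] exceeds 1/2, which excludes
   shorter permutations, and the densities of the patterns of length [k + 1] sum to
   less than 1/2, hence to 0, which excludes longer ones. *)
Let converges_eventually : converges R sigma -> eventually_t.
Proof.
move=> sigma_cvg.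
have [|n1 n1P] := (cvgn_cauchyP _).1 (sigma_cvg k t k_gt0) 2^-1; first by [].
have sum_cvg : cvgn (fun n => \sum_(u : 'S_k.+1) perm_density R u (sigma n)).
  by apply: is_cvg_sumn => u _; exact: sigma_cvg.
have [|n2 n2P] := (cvgn_cauchyP _).1 sum_cvg 2^-1; first by [].
have [n] := recurrent (maxn n1 n2); rewrite geq_max => /andP[n1n n2n] nt.
exists (maxn n1 n2) => m; rewrite geq_max => /andP[n1m n2m].
have := n1P n m n1n n1m; have := n2P n m n2n n2m; rewrite !sum_perm_density.
have -> : perm_density R t (sigma n) = 1.
  rewrite -[RHS](perm_density_self t).
  exact: (congr1 (fun q : {n & 'S_n} => perm_density R t (tagged q)) nt).
have -> : len n = k by exact: (congr1 (@tag _ _) nt).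
rewrite ltnn sub0r normrN ger0_norm ?ler0n// => len_le dens_gt.
have {}len_le : (len m <= k)%N.
  by rewrite leqNgt; apply/negP => lt_k; move: len_le; rewrite lt_k /= mulr1n; lra.
have {}dens_gt : 0 < perm_density R t (sigma m).
  by move: dens_gt; rewrite ltr_norml => /andP[]; lra.
have len_ge : (k <= len m)%N.
  by rewrite leqNgt; apply/negP => lt_k; move: dens_gt; rewrite /perm_density leqNgt lt_k ltxx.
have lenE : len m = k by apply/eqP; rewrite eqn_leq len_le.
move: (sigma m) dens_gt; rewrite lenE => s /perm_density_gt0_eq ->.
by [].
Qed.

Let rect_cauchy_eventually : rect_cauchy R sigma -> eventually_t.
Proof.
move=> sigma_cauchy; have [|n0 n0P] := sigma_cauchy (k%:R^-1 - k.+1%:R^-1).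
  by rewrite subr_gt0 ltf_pV2 ?posrE ?ltr0n// ltr_nat.
have [n n0n nt] := recurrent n0; exists n0 => m n0m.
have lenE : len n = k by exact: (congr1 (@tag _ _) nt).
rewrite -nt; apply: rect_dist_rigid => //.
have -> : (len n)%:R^-1 - (len n).+1%:R^-1 = k%:R^-1 - k.+1%:R^-1 :> R.
  by rewrite lenE.
exact: n0P.
Qed.

Let eventually_converges : eventually_t -> converges R sigma.
Proof.
move=> [n0 n0P] j u _; apply: (@cvgP _ _ (perm_density R u t)).
apply: cvg_near_cst; exists n0 => // n /= n0n.
exact: (congr1 (fun q : {n & 'S_n} => perm_density R u (tagged q)) (n0P n n0n)).
Qed.

Let eventually_rect_cauchy : eventually_t -> rect_cauchy R sigma.
Proof.
move=> [n0 n0P] e e0; exists n0 => n m n0n n0m.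
have -> : perm_rect_dist R (sigma n) (sigma m) = perm_rect_dist R t t.
  transitivity (perm_rect_dist R t (sigma m)).
    exact: (congr1 (fun q : {n & 'S_n} => perm_rect_dist R (tagged q) (sigma m)) (n0P n n0n)).
  exact: (congr1 (fun q : {n & 'S_n} => perm_rect_dist R t (tagged q)) (n0P m n0m)).
by apply: le_lt_trans (rect_dist_refl t k_gt0) _; rewrite lte_fin.
Qed.

(** Both properties force the sequence to be eventually constant. *)
Lemma recurrent_converges_iff : converges R sigma <-> rect_cauchy R sigma.
Proof.
split=> [/converges_eventually/eventually_rect_cauchy//|].
by move=> /rect_cauchy_eventually/eventually_converges.
Qed.

End Recurrent.

End Recurrence.

End Rigidity.

Theorem theorem1p6 (R : realType) (len : nat -> nat)
    (len_gt0 : forall n : nat, (0 < len n)%N)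
    (sigma : forall n : nat, 'S_(len n)) :
  converges R sigma <-> rect_cauchy R sigma.
Proof.
have [len_oo|[k [t recurrent]]] := len_infty_or_recurrent sigma; last first.
  exact: recurrent_converges_iff recurrent.
apply: iff_trans (iff_sym (rect_cauchy_corner_cauchy sigma len_gt0 len_oo)).
split; first exact: converges_corner_cauchy.
exact: corner_cauchy_converges.
Qed.
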